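(* For every $\varepsilon>0$ there exist $\delta>0$ and $n_0\in\mathbb N$ such that if $G$ is an $F_{3,2}$-free $3$-graph on $n\ge n_0$ vertices with $\delta_2(G)\ge(\frac13-\delta)n$, then $G$ lies at edit distance at most $\varepsilon\binom n3$ from a balanced $T_{A,B,C}$ construction on $n$ vertices.
   Context: A $3$-graph is a pair $(V,E)$ with $E$ a set of $3$-subsets of $V$. The codegree of two distinct vertices is the number of $3$-edges containing both; $\delta_2(G)$ is the minimum codegree over all pairs. $F_{3,2}$ is the $3$-graph on $\{1,\dots,5\}$ with $3$-edges $123,124,125,345$; $G$ is $F_{3,2}$-free if it has no subgraph isomorphic to $F_{3,2}$. For a partition $V=A\sqcup B\sqcup C$, $T_{A,B,C}$ is the $3$-graph on $V$ whose $3$-edges are all triples with two vertices in $A$ and one in $B$, or two in $B$ and one in $C$, or two in $C$ and one in $A$. It is balanced if $|A|,|B|,|C|$ differ pairwise by at most $1$. The edit distance between two $3$-graphs on $n$-vertex sets is the minimum number of triples whose edge/non-edge status must be changed to make the first isomorphic to the second. *)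

(* Defs.v *)
From HB Require Import structures.
From mathcomp Require Import all_boot all_order all_algebra reals.

Set Implicit Arguments.
Unset Strict Implicit.
Unset Printing Implicit Defensive.

Record graph3 (V : finType) := Graph3 {
  edges : {set {set V}};
  edgesP : [forall e in edges, #|e| == 3] }.

HB.instance Definition _ (V : finType) := [isSub for @edges V].
HB.instance Definition _ (V : finType) := [Finite of graph3 V by <:].

Lemma mk_graph3_subproof (V : finType) (P : pred {set V}) :
  [forall e in [set e : {set V} | (#|e| == 3) && P e], #|e| == 3].
Proof. by apply/forall_inP => e; rewrite inE => /andP[]. Qed.

Definition mk_graph3 (V : finType) (P : pred {set V}) : graph3 V :=
  Graph3 (mk_graph3_subproof P).

Definition codegree (V : finType) (G : graph3 V) (x y : V) : nat :=
  #|[set e in edges G | (x \in e) && (y \in e)]|.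

(* The initial value #|V| exceeds every codegree of a pair of distinct
   vertices, so it only matters when there is no such pair. *)
Definition min_codegree (V : finType) (G : graph3 V) : nat :=
  \big[minn/#|V|]_(p : V * V | p.1 != p.2) codegree G p.1 p.2.

(* The map need not preserve non-edges: the copy of [F] is a subgraph of [G],
   not necessarily an induced one. *)
Definition contains (U V : finType) (F : graph3 U) (G : graph3 V) : bool :=
  [exists f : {ffun U -> V},
     injectiveb f && [forall e in edges F, f @: e \in edges G]].

Definition isomorphic (V W : finType) (G : graph3 V) (H : graph3 W) : bool :=
  [exists f : {ffun V -> W},
     [&& injectiveb f, f @: [set: V] == [set: W] &
         [set f @: (e : {set V}) | e in edges G] == edges H]].

(* Vertices 1, ..., 5 are numbered 0, ..., 4: the edges are 123, 124, 125, 345. *)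
Definition F32 : graph3 'I_5 :=
  let v k : 'I_5 := inord k in
  mk_graph3 [in [set [set v 0; v 1; v 2]; [set v 0; v 1; v 3];
                     [set v 0; v 1; v 4]; [set v 2; v 3; v 4]]].

Definition F32_free (V : finType) (G : graph3 V) : bool := ~~ contains F32 G.

(* Parts are allowed to be empty, unlike with [partition]. *)
Definition tripartition (V : finType) (A B C : {set V}) : bool :=
  [&& [disjoint A & B], [disjoint B & C], [disjoint C & A] &
      A :|: B :|: C == [set: V]].

Definition T (V : finType) (A B C : {set V}) : graph3 V :=
  mk_graph3 [pred e : {set V} |
    [|| (#|e :&: A| == 2) && (#|e :&: B| == 1),
        (#|e :&: B| == 2) && (#|e :&: C| == 1) |
        (#|e :&: C| == 2) && (#|e :&: A| == 1)]].

Definition differ_by_at_most_1 (m n : nat) : bool := (m <= n.+1) && (n <= m.+1).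

Definition balanced (V : finType) (A B C : {set V}) : bool :=
  [&& differ_by_at_most_1 #|A| #|B|, differ_by_at_most_1 #|B| #|C| &
      differ_by_at_most_1 #|C| #|A|].

Definition edits (V : finType) (G G' : graph3 V) : {set {set V}} :=
  (edges G :\: edges G') :|: (edges G' :\: edges G).

(* No two 3-graphs on V differ in more than 'C(#|V|, 3) triples, so the initial
   value only matters when #|V| <> #|W|, where no G' exists. *)
Definition edit_distance (V W : finType) (G : graph3 V) (H : graph3 W) : nat :=
  \big[minn/'C(#|V|, 3)]_(G' : graph3 V | isomorphic G' H) #|edits G G'|.

(* Main.v *)
(** Write G(x, y) for the set of common neighbours of a pair.  A hypergraph is F32-free
    exactly when every G(x, y) spans no edge; hence a pair inside G(x, y) has a
    neighbourhood disjoint from G(x, y).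

    A cone is an apex w with base vertices x_1, ..., x_r such that every w x_i x_j is an
    edge.  For every r, cones on r base vertices have positive density.  Indeed, if a
    pattern has positive density then so do its blow-ups.  Put weights on the pairs of a
    fixed blow-up S.  By the codegree condition the pairs of S lying in the link of a
    random vertex p carry on average almost a third of the total weight, whereas
    F32-freeness forces them to carry less than a third unless S together with p contains
    a larger cone.  The passage from 3 to 4 base vertices distinguishes whether or not
    complete 4-vertex subgraphs have positive density.

    Take two apexes w, w' over a cone with a huge base.  The sets G(w, x_k) and G(w, w')
    are almost disjoint for some k, and the complement B of their union contains all the
    other G(x_i, x_j), so that each of the three has size about n/3.  For almost all u, v
    in B one gets G(u, v) close to C = G(w, w').  Such information rotates: when
    all pairs of X have neighbourhood close to Y, almost all pairs of Y have neighbourhood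
    close to the complement of the union of X and Y.  Two rotations give all the edges of
    T_{A,B,C} up to an error which is absorbed, as is the rebalancing, in the edit count. *)

Require Import Defs.
From mathcomp Require Import all_boot all_order all_algebra reals.
From mathcomp Require Import zify ring lra.

Set Implicit Arguments.
Unset Strict Implicit.
Unset Printing Implicit Defensive.

(** * Links in F32-free hypergraphs *)

(** Cones are what can keep growing: in [T A B C] each vertex of [B] is an apex over all of [A],
    whereas a complete subgraph on five vertices contains [F32]. The obstacle is that 1/3 leaves no
    slack in the averaging: the total weight passes three times the bound for one link only by a
    lower order term, so the weights are tuned until the competing bounds for a link tie. Pairs
    inside a part, which exist only in a blow-up, supply the excess. This is why positive density,
    and not mere existence, is carried from one cone to the next. Weights are integers, so an excess
    of 1 suffices, but the admissible [d] shrinks with the total weight; hence the size of the cone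
    is fixed before [d]. That size is dictated by the last stage, where the base indices serve as a
    sample of the vertices. Working with the sample costs [1 / r], which must be small against
    [e ^ 3]: one factor [e] for the exceptional vertices, two for the base pairs that an ordinary
    vertex may miss. *)

Record indep_nbhs (V : finType) (E : V -> V -> V -> bool) : Prop := IndepNbhs {
  adjC12 : forall x y z, E x y z = E y x z;
  adjC23 : forall x y z, E x y z = E x z y;
  adj_irr : forall x y, E x x y = false;
  adj_indep : forall x y a b c, E x y a -> E x y b -> E x y c -> E a b c = false }.

Lemma adj_rot (V : finType) (E : V -> V -> V -> bool) x y z :
  indep_nbhs E -> E x y z = E y z x.
Proof. by move=> HE; rewrite (adjC12 HE) (adjC23 HE). Qed.

Definition pattern (J : finType) := J -> J -> J -> bool.

Definition pat_hom (J V : finType) (pat : pattern J) (E : V -> V -> V -> bool) (f : J -> V) :=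
  [forall a, forall b, forall c, pat a b c ==> E (f a) (f b) (f c)].

Lemma pat_homP (J V : finType) (pat : pattern J) (E : V -> V -> V -> bool) (f : J -> V) :
  reflect (forall a b c, pat a b c -> E (f a) (f b) (f c)) (pat_hom pat E f).
Proof.
apply: (iffP forallP) => [H a b c|H a].
  by move/forallP: (H a) => /(_ b)/forallP/(_ c)/implyP.
by apply/forallP => b; apply/forallP => c; apply/implyP/H.
Qed.

Lemma eq_hom (J V : finType) (pat : pattern J) (E : V -> V -> V -> bool) (f g : J -> V) :
  f =1 g -> pat_hom pat E f = pat_hom pat E g.
Proof. by move=> fg; apply/pat_homP/pat_homP => H a b c /H; rewrite !fg. Qed.

Definition covers_pairs (J : finType) (pat : pattern J) :=
  forall a b, a != b -> exists c, pat a b c.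

(** A collision would turn the triple of [pat] through the two points into a degenerate one.
    Homomorphisms can thus be counted with no injectivity condition. *)
Lemma covers_inj (J V : finType) (pat : pattern J) (E : V -> V -> V -> bool) (f : J -> V) :
  indep_nbhs E -> covers_pairs pat -> pat_hom pat E f -> injective f.
Proof.
move=> HE cov /pat_homP fE a b fab; apply/eqP/negPn/negP => /cov[c /fE].
by rewrite fab (adj_irr HE).
Qed.

Definition blown_hom (J K V : finType) (pat : pattern J) (E : V -> V -> V -> bool)
    (f : J * K -> V) :=
  forall a b c i j k, pat a b c -> E (f (a, i)) (f (b, j)) (f (c, k)).

Definition link_weight (I V : finType) (E : V -> V -> V -> bool) (ws : seq (I * I * nat))
    (f : I -> V) (p : V) :=
  (\sum_(t <- ws) t.2 * E p (f t.1.1) (f t.1.2))%N.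

(* [None] stands for the new vertex [p] and [Some i] for [f i]. *)
Definition extend_hom (I J V : finType) (pat : pattern J) (E : V -> V -> V -> bool)
    (f : I -> V) (p : V) :=
  exists s : {ffun J -> option I}, pat_hom pat E (fun j => oapp f p (s j)).

Definition complete_pat (J : finType) : pattern J := fun a b c => uniq [:: a; b; c].

Definition cone_pat (Q : finType) : pattern (option Q) :=
  fun a b c => complete_pat a b c && (None \in [:: a; b; c]).

Lemma complete_pat_neq (J : finType) (a b c : J) :
  complete_pat a b c -> [/\ a != b, b != c & a != c].
Proof. by rewrite /complete_pat /= !inE negb_or andbT => /andP[/andP[-> ->] ->]. Qed.

Lemma complete_pat_cover (J : finType) : (2 < #|J|)%N -> covers_pairs (@complete_pat J).
Proof.
move=> J3 a b ab; have: (0 < #|~: [set a; b]|)%N by rewrite cardsCs setCK cards2 ab; lia.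
case/card_gt0P => c; rewrite !inE negb_or => /andP[ca cb]; exists c.
by rewrite /complete_pat /= !inE negb_or ab eq_sym ca eq_sym cb.
Qed.

Lemma cone_pat_cover (Q : finType) : (1 < #|Q|)%N -> covers_pairs (@cone_pat Q).
Proof.
move=> Q2.
have other i : exists j : Q, i != j.
  have: (0 < #|~: [set i]|)%N by rewrite cardsCs setCK cards1; lia.
  by case/card_gt0P => j; rewrite !inE eq_sym; exists j.
move=> [i|] [j|] // ij.
- by exists None; rewrite /cone_pat /complete_pat /= !inE !orbF ij.
- have [j ij'] := other i; exists (Some j).
  by rewrite /cone_pat /complete_pat /= !inE /= ?andbT ?orbF; apply: ij'.
- have [i ij'] := other j; exists (Some i).
  by rewrite /cone_pat /complete_pat /= !inE /= ?andbT ?orbF; apply: ij'.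
Qed.

Section Extend.
Variables (I V : finType) (E : V -> V -> V -> bool) (f : I -> V) (p : V).
Hypothesis HE : indep_nbhs E.

Lemma cone_homP (Q : finType) (g : option Q -> V) :
  (forall i j, i != j -> E (g None) (g (Some i)) (g (Some j))) -> pat_hom (@cone_pat Q) E g.
Proof.
move=> H; apply/pat_homP => -[i|] [j|] [k|] //=;
  rewrite /cone_pat /complete_pat /= ?inE ?orbF ?andbF //= ?andbT.
- by move=> ij; rewrite -(adj_rot _ _ _ HE); apply: H.
- by move=> ij; rewrite (adjC12 HE); apply: H.
- by move=> ij; apply: H.
Qed.

Lemma extend_cone (Q : finType) (u : option I) (q : Q -> option I) :
  (forall i j, i != j -> E (oapp f p u) (oapp f p (q i)) (oapp f p (q j))) ->
  extend_hom (@cone_pat Q) E f p.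
Proof.
move=> H; exists [ffun o => if o is Some i then q i else u].
by apply: cone_homP => i j ij; rewrite !ffunE; apply: H.
Qed.

End Extend.

(** * Extending a cone *)

Section ConeStep.
Variable Q : finType.
Local Notation r := #|Q|.
Hypothesis Q3 : 2 < r.

Let M := 4 * r * r * (r - 1).

(* The vertex [(None, b)] is the [b]-th copy of the apex and [(Some i, a)] the [a]-th
   copy of the [i]-th base vertex.  A link made of all pairs of base copies from
   different parts, or of all apex-base pairs but those of one part, weighs exactly
   [M]; the total weight is [3 * M + 2 * (r - 1)]. *)
Definition cone_weights : seq ((option Q * bool) * (option Q * bool) * nat) :=
  ((None, false), (None, true), M - 4 * r * r - 2) ::
  [seq ((None, t.1.1), (Some t.1.2, t.2), r * r) | t <- enum {: bool * Q * bool}] ++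
  [seq ((Some i, false), (Some i, true), 2) | i <- enum Q] ++
  [seq ((Some t.1.1, t.2.1), (Some t.1.2, t.2.2), r)
     | t <- enum {: (Q * Q) * (bool * bool)} & t.1.1 != t.1.2].

Lemma cone_weights_neq t : t \in cone_weights -> t.1.1 != t.1.2.
Proof.
rewrite inE !mem_cat => /or4P[/eqP->//|/mapP[[[b i] a] _ ->]//|/mapP[i _ ->]|].
  by rewrite /= xpair_eqE andbF.
case/mapP => -[[i j] [a b]]; rewrite mem_filter => /andP[/= ij _ ->] /=.
by rewrite xpair_eqE negb_and; apply/orP; left; apply: ij.
Qed.

Lemma sum_cone_weights (F : option Q * bool -> option Q * bool -> nat) :
  \sum_(t <- cone_weights) t.2 * F t.1.1 t.1.2 =
  (M - 4 * r * r - 2) * F (None, false) (None, true) +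
  (r * r * (\sum_b \sum_i \sum_a F (None, b) (Some i, a)) +
  (2 * (\sum_i F (Some i, false) (Some i, true)) +
   r * \sum_i \sum_(j | i != j) \sum_a \sum_c F (Some i, a) (Some j, c))).
Proof.
rewrite big_cons !big_cat !big_map big_filter !big_enum_cond /=.
congr (_ + (_ + (_ + _))); rewrite -?big_distrr /= -?enumT ?big_enum /=.
- by rewrite !pair_bigA.
- by [].
- congr (_ * _); under [RHS]eq_bigr => i _ do under eq_bigr => j _ do rewrite pair_bigA.
  by rewrite !pair_big_dep /=; apply: eq_bigl => t; rewrite andbT.
Qed.
End ConeStep.

Lemma leq_sum_const (T : finType) (F : T -> nat) k : (forall t, F t <= k) -> \sum_t F t <= #|T| * k.
Proof. by move=> H; rewrite -sum_nat_const; apply: leq_sum => t _. Qed.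

Lemma leq_sum_single (T : finType) (F : T -> nat) t0 k :
  (forall t, t != t0 -> F t = 0) -> F t0 <= k -> \sum_t F t <= k.
Proof. by move=> H Fk; rewrite (bigD1 t0) //= big1 ?addn0. Qed.

(** Each of the twelve pairs lies in two of the eight triples [(b, a, c)], so twice the sum is at
    most 16. *)
Lemma square_bound (u v e : bool -> bool -> nat) :
  (forall b a c, u b a + v b c + e a c <= 2) ->
  \sum_b ((u b true + u b false) + (v b true + v b false)) + \sum_a \sum_c e a c <= 8.
Proof.
move=> H; rewrite !big_bool /=.
have := H false false false; have := H false false true.
have := H false true false; have := H false true true.
have := H true false false; have := H true false true.
have := H true true false; have := H true true true.
lia.
Qed.

Lemma mixed_bound3 w m : w + m <= 8 ->
  3 * 3 * w + (2 * 0 + 3 * (2 * m)) <= 4 * 3 * 3 * (3 - 1).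
Proof. lia. Qed.

(** For [q = 3] the left side could reach 96, the right side being 72. This is what makes the step
    from three base vertices special. *)
Lemma mixed_bound4 q w m : 3 < q -> w <= 8 -> m <= 4 ->
  q * q * w + (2 * 0 + q * (2 * m)) <= 4 * q * q * (q - 1).
Proof.
move=> q3 w8 m4.
have h1 : q * q * w <= q * q * 8 by rewrite leq_mul2l w8 orbT.
have h2 : q * (2 * m) <= q * 8 by rewrite leq_mul2l; lia.
have h3 : q * (q * 8 + 8) <= q * (q * 12) by rewrite leq_mul2l; lia.
have h4 : q * (q * 12) <= q * (q * (4 * (q - 1))) by rewrite !leq_mul2l; lia.
have E1 : q * (q * 8 + 8) = q * q * 8 + q * 8 by ring.
have E2 : 4 * q * q * (q - 1) = q * (q * (4 * (q - 1))) by ring.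
by rewrite add0n E2; apply: leq_trans (leq_trans h3 h4); rewrite E1 leq_add.
Qed.

Lemma single_bound q d z0 z1 y0 y1 : 2 < q -> d <= 1 -> z0 <= 2 -> z1 <= 2 -> y0 <= 2 ->
  y1 <= 2 * (q - 1) -> z1 = 0 \/ y1 <= 2 ->
  q * q * (z0 + z1) + (2 * d + q * (2 * (y0 + y1))) <= 4 * q * q * (q - 1).
Proof.
case: q => [|[|[|t]]] // _ d1 h0 h1 g0; rewrite subn1 /= => g1 H.
have {H}[E|g2] := H.
  rewrite E addn0.
  apply: leq_trans (_ : t.+3 * t.+3 * 2 + (2 * 1 + t.+3 * (2 * (2 + 2 * t.+2))) <= _); last by nia.
  by rewrite !leq_add ?leq_mul ?leq_add.
apply: leq_trans (_ : t.+3 * t.+3 * (2 + 2) + (2 * 1 + t.+3 * (2 * (2 + 2))) <= _); last by nia.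
by rewrite !leq_add ?leq_mul ?leq_add.
Qed.

(** One missing pair, counted in both orders with weight [q], costs [2 * q] and so pays for all [q]
    pairs inside parts, of weight 2 each. *)
Lemma diag_bound q d x : 2 < q -> d <= q -> x + 2 <= 4 * q * (q - 1) ->
  2 * d + q * x <= 4 * q * q * (q - 1).
Proof.
move=> q2 dq xq; have := leq_mul (leqnn q) xq; rewrite mulnDr.
have -> : q * (4 * q * (q - 1)) = 4 * q * q * (q - 1) by ring.
lia.
Qed.

(** The weight of the apex pair is chosen to give equality here when [w = 4] and [d = 1], the most
    that can accompany that pair. *)
Lemma pair_bound q w d : 2 < q -> w <= 4 -> d <= 1 ->
  4 * q * q * (q - 1) - 4 * q * q - 2 + (q * q * w + 2 * d) <= 4 * q * q * (q - 1).
Proof.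
case: q => [|[|[|t]]] // _ w4 d1; rewrite subn1 /=.
have := leq_mul (leqnn (t.+3 * t.+3)) w4; nia.
Qed.

Lemma pair_bound0 q d : 2 < q -> d <= q ->
  4 * q * q * (q - 1) - 4 * q * q - 2 + 2 * d <= 4 * q * q * (q - 1).
Proof. by case: q => [|[|[|t]]] // _ dq; rewrite subn1 /=; nia. Qed.

(** * The weight of a link in a blown-up cone *)

Section LinkBound.
Variables (Q : finType) (lww : bool) (lw : bool -> Q -> bool -> bool).
Variables (lx : Q -> bool -> Q -> bool -> bool).
Local Notation r := #|Q|.
Hypothesis Q3 : 2 < r.
Hypothesis lxC : forall i a j c, lx i a j c = lx j c i a.
Hypothesis lw_lx : forall b i a j c k d, lw b i a -> j != i -> k != i -> lx j c k d = false.
Hypothesis lww_lx : forall i a j c, lww -> i != j -> lx i a j c = false.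
Hypothesis lww_lw : forall b i a j c, lww -> lw b i a -> lw b j c -> i = j.
Hypothesis lw_star : forall b i a j c k d,
  lw b i a -> lx i a j c -> lx i a k d -> j != i -> k != i -> j = k.
Hypothesis no_transversal : forall b, exists i, forall a, lw b i a = false.
Hypothesis no_clique : forall i, lx i false i true ->
  exists j c k d, j != k /\ lx j c k d = false.
Hypothesis no_K4 : r = 3 -> forall b i a j c, i != j -> lw b i a -> lw b j c -> lx i a j c = false.

Let n i j := \sum_a \sum_c lx i a j c.
Let W := \sum_b \sum_i \sum_a lw b i a.
Let D := \sum_i lx i false i true.
Let X := \sum_i \sum_(j | i != j) n i j.

Let n_le4 i j : n i j <= 4.
Proof. by rewrite /n !big_bool; do 4 case: (lx _ _ _ _). Qed.

Let D_single i0 : (forall i, lx i false i true -> i = i0) -> D <= 1.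
Proof.
move=> H; apply: (leq_sum_single (t0 := i0)) => [i|]; last exact: leq_b1.
by apply: contraNeq; case E: (lx _ _ _ _) => // _; rewrite (H _ E).
Qed.

Let D_le : D <= r.
Proof. by rewrite -[r]muln1; apply: leq_sum_const => i; apply: leq_b1. Qed.

Let D_of_lw b i a : lw b i a -> forall j, lx j false j true -> j = i.
Proof.
move=> H j; case: (altP (j =P i)) => // ji; rewrite (lw_lx _ _ H) //.
Qed.

Let X_gap : X + \sum_i \sum_(j | i != j) (4 - n i j) = 4 * r * (r - 1).
Proof.
rewrite -big_split /= (eq_bigr (fun=> 4 * (r - 1))) => [|i _].
  by rewrite sum_nat_const; ring.
rewrite -big_split /= (eq_bigr (fun=> 4)) => [|j _]; last by rewrite subnKC ?n_le4.
rewrite sum_nat_const mulnC; congr (_ * _).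
rewrite (_ : #|_| = #|~: [set i]|); last by apply: eq_card => j; rewrite !inE eq_sym.
by rewrite cardsCs setCK cards1.
Qed.

Let X_le : X <= 4 * r * (r - 1).
Proof. by rewrite -X_gap leq_addr. Qed.

Let n_missing i j a c : lx i a j c = false -> 0 < 4 - n i j.
Proof.
by rewrite /n !big_bool; case: a; case: c => ->; do 3 case: (lx _ _ _ _).
Qed.

(** [X] runs over ordered pairs of parts, so a missing pair is missed twice. *)
Let X_missing : (exists j c k d, j != k /\ lx j c k d = false) -> X + 2 <= 4 * r * (r - 1).
Proof.
case=> j [c [k [d [jk E]]]]; rewrite -X_gap leq_add2l.
rewrite (bigD1 j) //= -[2]/(1 + 1); apply: leq_add.
  by rewrite (bigD1 k) //=; apply: leq_trans (leq_addr _ _); apply: n_missing E.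
rewrite (bigD1 k) 1?eq_sym //=; apply: leq_trans (leq_addr _ _).
rewrite (bigD1 j) 1?eq_sym //=; apply: leq_trans (leq_addr _ _).
by apply: n_missing; rewrite lxC; apply: E.
Qed.

Let X0 : (forall i j a c, i != j -> lx i a j c = false) -> X = 0.
Proof.
move=> H; apply: big1 => i _; apply: big1 => j ij; apply: big1 => a _.
by apply: big1 => c _; rewrite H.
Qed.

Let n_sym i j : n i j = n j i.
Proof.
by rewrite /n exchange_big; apply: eq_bigr => c _; apply: eq_bigr => a _; rewrite lxC.
Qed.

Let X_touch j0 : (forall i j a c, i != j -> i != j0 -> j != j0 -> lx i a j c = false) ->
  X = 2 * \sum_(k | j0 != k) n j0 k.
Proof.
move=> H; rewrite /X (bigD1 j0) //= mul2n -addnn; congr addn.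
rewrite (eq_bigl (fun k => j0 != k)) => [|k]; last by rewrite eq_sym.
apply: eq_bigr => k jk; rewrite (bigD1 j0) 1?eq_sym //= big1 ?addn0 1?n_sym //.
move=> i /andP[ki ij]; apply: big1 => a _; apply: big1 => c _.
by rewrite H // eq_sym.
Qed.

Let W_le : W <= 4 * (r - 1).
Proof.
apply: leq_trans (leq_sum_const (k := 2 * (r - 1)) _) _; last by rewrite card_bool mulnA.
move=> b; have [i0 Hi0] := no_transversal b.
rewrite (bigD1 i0) //= big1 ?add0n => [|a _]; last by rewrite Hi0.
apply: leq_trans (_ : \sum_(i | i != i0) 2 <= _).
  by apply: leq_sum => i _; rewrite big_bool; do 2 case: (lw _ _ _).
rewrite sum_nat_const mulnC leq_mul2l /=.
rewrite (_ : #|_| = #|~: [set i0]|); last by apply: eq_card => j; rewrite !inE.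
by rewrite cardsCs setCK cards1.
Qed.

Let M := 4 * r * r * (r - 1).

(* Both parts [j] and [k] are joined to an apex: only pairs between these two parts
   survive in the link, and [no_K4] is needed exactly when [r = 3]. *)
Let link_bound_two j k b0 a0 b1 a1 : j != k -> lw b0 j a0 -> lw b1 k a1 ->
  r * r * W + (2 * D + r * X) <= M.
Proof.
move=> jk lj lk.
have lx0 i i' a c : i != i' -> (i != j) && (i' != j) || (i != k) && (i' != k) ->
    lx i a i' c = false.
  by move=> ii' /orP[]/andP[h1 h2]; [apply: lw_lx lj h1 h2 | apply: lw_lx lk h1 h2].
have XE : X = 2 * n j k.
  rewrite (X_touch (j0 := j)) => [|i i' a c ii' ij ij']; last by apply: lx0; rewrite // ij ij'.
  congr (2 * _); rewrite (bigD1 k) //= big1 ?addn0 // => i /andP[ji ik].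
  apply: big1 => a _; apply: big1 => c _; rewrite lx0 //.
  by rewrite jk ik orbT.
have D0 : D = 0.
  apply: big1 => i _; case E: (lx _ _ _ _) => //.
  by rewrite -(D_of_lw lj E) (D_of_lw lk E) eqxx in jk.
have [X0'|Xpos] := posnP (n j k).
  rewrite XE X0' D0 !muln0 !addn0 /M.
  by apply: leq_trans (leq_mul (leqnn _) W_le) _; rewrite !mulnA [r * r * 4]mulnC !mulnA.
(* By [lw_lx], an apex joined to a third part would empty the link between [j] and [k]. *)
have W2 i b a : lw b i a -> (i == j) || (i == k).
  move=> l; apply/negPn/negP; rewrite negb_or => /andP[ij ik].
  suff nz : n j k = 0 by rewrite nz in Xpos.
  apply: big1 => a' _; apply: big1 => c _.
  by rewrite (lw_lx _ _ l) // eq_sym.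
have WE : W = \sum_b ((lw b j true + lw b j false) + (lw b k true + lw b k false)).
  apply: eq_bigr => b _; rewrite (bigD1 j) //= (bigD1 k) 1?eq_sym //= [X in _ + (_ + X)]big1.
    by rewrite !big_bool addn0.
  move=> i /andP[ij ik].
  apply: big1 => a _; case E: (lw _ _ _) => //.
  by have := W2 _ _ _ E; rewrite (negPf ij) (negPf ik).
have [r3|r4] := eqVneq r 3.
  have WX : W + n j k <= 8.
    rewrite WE /n; apply: (square_bound (u := fun b a => lw b j a) (v := fun b a => lw b k a)).
    move=> b a c; have := no_K4 r3 (b := b) (a := a) (c := c) jk.
    by case: (lw b j a); case: (lw b k c); case: (lx j a k c) => // /(_ isT isT).
  rewrite D0 XE /M r3.
  exact: mixed_bound3.
have W8 : W <= 8.
  by rewrite WE !big_bool; do 8 case: (lw _ _ _).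
by rewrite D0 XE; apply: mixed_bound4 => //; rewrite ltn_neqAle eq_sym r4.
Qed.

(* Only part [j] is joined to the apexes, so every remaining pair touches it, and by
   [lw_star] a vertex joined to an apex sees a single other part. *)
Let link_bound_one j b0 a0 : (forall b i a, lw b i a -> i = j) -> lw b0 j a0 ->
  r * r * W + (2 * D + r * X) <= M.
Proof.
move=> Wj lj.
have D1 := D_single (D_of_lw lj).
have XE := X_touch (fun i i' a c _ ij ij' => lw_lx a c lj ij ij').
pose Y a := \sum_(k | j != k) \sum_c lx j a k c.
have XY : X = 2 * (Y true + Y false).
  rewrite XE /Y -big_split /=; congr (2 * _); apply: eq_bigr => k _.
  by rewrite /n !big_bool.
pose Z a := lw true j a + lw false j a.
have Wb b : \sum_i \sum_a lw b i a = lw b j true + lw b j false.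
  rewrite (bigD1 j) //= big_bool [X in _ + X]big1 ?addn0 // => i ij.
  by apply: big1 => a _; case E: (lw _ _ _) => //; rewrite (Wj _ _ _ E) eqxx in ij.
have WZ : W = Z true + Z false by rewrite /W big_bool !Wb addnACA.
have Y_le a : Y a <= 2 * (r - 1).
  apply: leq_trans (_ : \sum_(k | j != k) 2 <= _).
    by apply: leq_sum => i _; rewrite big_bool; do 2 case: (lx _ _ _ _).
  rewrite sum_nat_const mulnC leq_mul2l /=.
  rewrite (_ : #|_| = #|~: [set j]|); last by apply: eq_card => i; rewrite !inE eq_sym.
  by rewrite cardsCs setCK cards1.
have Y_touched b a : lw b j a -> Y a <= 2.
  move=> l; have [->//|Ypos] := posnP (Y a).
  have [/existsP[k /existsP[c /andP[jk lk]]]|/existsPn H] :=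
    boolP [exists k, [exists c, (j != k) && lx j a k c]]; last first.
    suff Y0 : Y a = 0 by rewrite Y0 in Ypos.
    apply: big1 => k jk; apply: big1 => c _; case E: (lx _ _ _ _) => //.
    by have /existsPn/(_ c) := H k; rewrite jk E.
  rewrite /Y (bigD1 k) //= [X in _ + X]big1 ?addn0.
    by rewrite big_bool; do 2 case: (lx _ _ _ _).
  move=> i /andP[ji ik]; apply: big1 => d _; case E: (lx _ _ _ _) => //.
  by rewrite (lw_star l E lk) ?eqxx // 1?eq_sym in ik.
have ZY a : Z a = 0 \/ Y a <= 2.
  rewrite /Z; case E1: (lw true j a); first by right; apply: Y_touched E1.
  by case E2: (lw false j a); [right; apply: Y_touched E2 | left].
have Z_le a : Z a <= 2 by rewrite /Z; do 2 case: (lw _ _ _).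
have Za0 : Y a0 <= 2 by apply: Y_touched lj.
rewrite XY WZ; case: (a0) Za0 => Y2.
  exact: (single_bound Q3 D1 (Z_le true) (Z_le false) Y2 (Y_le false) (ZY false)).
rewrite [Z true + _]addnC [Y true + _]addnC.
exact: (single_bound Q3 D1 (Z_le false) (Z_le true) Y2 (Y_le true) (ZY true)).
Qed.

Let link_bound_cone : r * r * W + (2 * D + r * X) <= M.
Proof.
have [|W0] := boolP [exists b, [exists i, [exists a, lw b i a]]]; last first.
  have -> : W = 0.
    apply: big1 => b _; apply: big1 => i _; apply: big1 => a _.
    move: W0; rewrite negb_exists => /forallP/(_ b); rewrite negb_exists => /forallP/(_ i).
    by rewrite negb_exists => /forallP/(_ a); case: (lw _ _ _).
  have [|D0] := boolP [exists i, lx i false i true]; last first.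
    have -> : D = 0.
      apply: big1 => i _; move: D0; rewrite negb_exists => /forallP/(_ i).
      by case: (lx _ _ _ _).
    by rewrite muln0 !add0n; apply: leq_trans (leq_mul (leqnn r) X_le) _; rewrite /M; nia.
  case/existsP => i /no_clique/X_missing Xm.
  by rewrite muln0 add0n; apply: diag_bound Q3 D_le Xm.
case/existsP => b0 /existsP[j /existsP[a0 lj]].
have [/existsP[b /existsP[k /existsP[a /andP[kj lk]]]]|H] :=
  boolP [exists b, [exists k, [exists a, (k != j) && lw b k a]]].
  by apply: link_bound_two lj lk; rewrite eq_sym.
apply: link_bound_one lj => b i a l; apply/eqP/negPn/negP => ij.
move: H; rewrite negb_exists => /forallP/(_ b); rewrite negb_exists => /forallP/(_ i).
by rewrite negb_exists => /forallP/(_ a); rewrite ij l.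
Qed.

Lemma link_bound :
  (M - 4 * r * r - 2) * lww + (r * r * W + (2 * D + r * X)) <= M.
Proof.
case E: lww; last by rewrite muln0 add0n link_bound_cone.
rewrite muln1 X0 => [|i j a c ij]; last by rewrite lww_lx.
rewrite muln0 addn0.
have [/existsP[b0 /existsP[j /existsP[a0 lj]]]|W0] :=
  boolP [exists b, [exists i, [exists a, lw b i a]]].
  have W4 : W <= 4.
    apply: leq_trans (leq_sum_const (k := 2) _) _; last by rewrite card_bool.
    move=> b; have [/existsP[i /existsP[a l]]|H] := boolP [exists i, [exists a, lw b i a]].
      apply: (leq_sum_single (t0 := i)) => [k ki|].
        apply: big1 => c _; case E': (lw _ _ _) => //.
        by rewrite (lww_lw E l E') eqxx in ki.
      by rewrite big_bool; do 2 case: (lw _ _ _).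
    rewrite big1 // => i _; apply: big1 => a _.
    move: H; rewrite negb_exists => /forallP/(_ i).
    by rewrite negb_exists => /forallP/(_ a); case: (lw _ _ _).
  by have := D_single (D_of_lw lj); apply: (pair_bound Q3 W4).
have -> : W = 0.
  apply: big1 => b _; apply: big1 => i _; apply: big1 => a _.
  move: W0; rewrite negb_exists => /forallP/(_ b); rewrite negb_exists => /forallP/(_ i).
  by rewrite negb_exists => /forallP/(_ a); case: (lw _ _ _).
by rewrite muln0 add0n; apply: (pair_bound0 Q3 D_le).
Qed.

End LinkBound.

(* Four vertices, presented so that the cone over [K4] follows the cone over
   [option bool] in the tower of cones. *)
Definition K4 : finType := option (option bool).

Lemma extend_complete4 (I V : finType) (E : V -> V -> V -> bool) (f : I -> V) (p : V)
    (u0 u1 u2 u3 : option I) : indep_nbhs E ->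
  E (oapp f p u0) (oapp f p u1) (oapp f p u2) -> E (oapp f p u0) (oapp f p u1) (oapp f p u3) ->
  E (oapp f p u0) (oapp f p u2) (oapp f p u3) -> E (oapp f p u1) (oapp f p u2) (oapp f p u3) ->
  extend_hom (@complete_pat K4) E f p.
Proof.
move=> HE E1 E2 E3 E4.
exists [ffun o : K4 => match o with
  | None => u0 | Some None => u1 | Some (Some false) => u2 | Some (Some true) => u3 end].
have C12 := adjC12 HE; have C23 := adjC23 HE.
apply/pat_homP => -[[[]|]|] [[[]|]|] [[[]|]|] // _; rewrite !ffunE /=;
first [by [] | by rewrite C12 | by rewrite C23 | by rewrite C12 C23 | by rewrite C23 C12
      | by rewrite C12 C23 C12].
Qed.

Section ConePointwise.
Variables (Q V : finType) (E : V -> V -> V -> bool) (f : option Q * bool -> V) (p : V).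
Local Notation r := #|Q|.
Hypotheses (Q3 : 2 < r) (HE : indep_nbhs E) (fE : blown_hom (@cone_pat Q) E f).

Let w b := f (None, b).
Let x i a := f (Some i, a).

Let wxx b i a j c : i != j -> E (w b) (x i a) (x j c).
Proof.
move=> ij; apply: fE; rewrite /cone_pat /complete_pat /= !inE /= ?andbT.
exact: ij.
Qed.

Let lww := E p (w false) (w true).
Let lw b i a := E p (w b) (x i a).
Let lx i a j c := E p (x i a) (x j c).

(** Every restriction on the link of [p] is either an edge that would lie inside a common
    neighbourhood, that of the first two arguments of [ind], or a larger cone or a complete 4-vertex
    subgraph through [p]. *)
Lemma cone_pointwise :
  [\/ link_weight E (cone_weights Q) f p <= 4 * r * r * (r - 1),
      extend_hom (@cone_pat (option Q)) E f p
    | r = 3 /\ extend_hom (@complete_pat K4) E f p].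
Proof.
have C12 := adjC12 HE; have C23 := adjC23 HE; have ind := adj_indep HE.
have [/existsP[s Hs]|no1] := boolP [exists s : {ffun option (option Q) -> option (option Q * bool)},
    pat_hom (@cone_pat (option Q)) E (fun j => oapp f p (s j))].
  by apply: Or32; exists s.
have [/andP[/eqP r3 /existsP[s Hs]]|no2] := boolP ((r == 3) &&
  [exists s : {ffun K4 -> option (option Q * bool)},
    pat_hom (@complete_pat K4) E (fun j => oapp f p (s j))]).
  by apply: Or33; split => //; exists s.
apply: Or31.
have {}no1 : ~ extend_hom (@cone_pat (option Q)) E f p.
  by move=> [s Hs]; move/existsPn/(_ s): no1; rewrite Hs.
have {}no2 : r = 3 -> ~ extend_hom (@complete_pat K4) E f p.
  by move=> r3 [s Hs]; move: no2; rewrite r3 /= => /existsPn/(_ s); rewrite Hs.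
rewrite /link_weight (sum_cone_weights (fun u v => E p (f u) (f v))).
apply: (@link_bound Q lww lw lx Q3).
- by move=> i a j c; apply: C23.
- move=> b i a j c k d l ji ki; apply: (ind (w b) (x i a)).
  + by rewrite -(adj_rot _ _ _ HE).
  + by apply: wxx; rewrite eq_sym.
  + by apply: wxx; rewrite eq_sym.
- move=> i a j c l ij; apply/negP => l'; have := ind (x i a) (x j c) p (w false) (w true).
  rewrite -/lww l -!(adj_rot _ (x i a) (x j c) HE) => H.
  by have := H l' (wxx _ _ _ ij) (wxx _ _ _ ij).
- move=> b i a j c l l1 l2; apply/eqP/negPn/negP => ij.
  have := ind p (w b) (w (~~ b)) (x i a) (x j c); rewrite wxx // => H.
  suff l' : E p (w b) (w (~~ b)) by have := H l' l1 l2.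
  by case: (b) => //=; rewrite C23.
- move=> b i a j c k d l l1 l2 ji ki; apply/eqP/negPn/negP => jk.
  have := ind p (x i a) (w b) (x j c) (x k d); rewrite wxx // => H.
  by have := H _ l1 l2; rewrite C23 => /(_ l).
- move=> b; have [/existsP[i /forallP H]|/existsPn H] := boolP [exists i, [forall a, ~~ lw b i a]].
    by exists i => a; apply: negbTE.
  (* If [w b] is joined to every part, it is an apex over [p] and one joined copy from each part.
     The boolean [lw b i true] names such a copy: [true] if that one is joined, else [false]. *)
  case: no1; apply: (@extend_cone _ _ E f p HE _ (Some (None, b))
    (fun o => if o is Some i then Some (Some i, lw b i true) else None)).
  have l i : lw b i (lw b i true).
    have := H i; rewrite negb_forall => /existsP[a]; rewrite negbK.
    by case E1: (lw b i true) => //; case: a => //; rewrite E1.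
  move=> [i|] [j|] //= ij; first exact: wxx.
    by rewrite C23; have := l i; rewrite /lw C12.
  by have := l j; rewrite /lw C12.
- move=> i di; have [/existsP[j /existsP[c /existsP[k /existsP[d /andP[jk nl]]]]]|H] :=
    boolP [exists j, [exists c, [exists k, [exists d, (j != k) && ~~ lx j c k d]]]].
    by exists j, c, k, d; split => //; apply: negbTE.
  (* Otherwise [p] is an apex over the first copies of all parts together with the second copy of
     part [i]. *)
  case: no1; apply: (@extend_cone _ _ E f p HE _ None
    (fun o => if o is Some j then Some (Some j, false) else Some (Some i, true))).
  have l j c k d : j != k -> lx j c k d.
    move=> jk; move: H; rewrite negb_exists => /forallP/(_ j).
    rewrite negb_exists => /forallP/(_ c).
    rewrite negb_exists => /forallP/(_ k); rewrite negb_exists => /forallP/(_ d).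
    by rewrite jk negbK.
  move=> [j|] [k|] //= jk; first exact: l.
    have [->|ji] := eqVneq j i; [exact: di | exact: l].
  by rewrite C23; have [->|ki] := eqVneq k i; [exact: di | apply: l].
- move=> r3 b i a j c ij l1 l2; apply/negP => l3; apply: (no2 r3).
  by apply: (@extend_complete4 _ _ E f p None (Some (None, b)) (Some (Some i, a))
     (Some (Some j, c)) HE) => //=; apply: wxx.
Qed.
End ConePointwise.

Section ConeStep.
Variable Q : finType.
Local Notation r := #|Q|.

Lemma cone_weights_total : 2 < r ->
  3 * (4 * r * r * (r - 1)) < \sum_(t <- cone_weights Q) t.2.
Proof.
move=> Q3; have := @sum_cone_weights Q (fun _ _ => 1).
under eq_bigr => t _ do rewrite muln1; move=> ->.
have -> : \sum_(b : bool) \sum_(i : Q) \sum_(a : bool) 1 = 4 * r.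
  by rewrite big_bool !sum_nat_const card_bool /= -[#|xpredT|]/r; lia.
have -> : \sum_(i : Q) 1 = r by rewrite sum1_card.
have -> : \sum_(i : Q) \sum_(j | i != j) \sum_(a : bool) \sum_(c : bool) 1 = 4 * r * (r - 1).
  rewrite (eq_bigr (fun=> 4 * (r - 1))) => [|i _]; first by rewrite sum_nat_const; ring.
  rewrite big_bool !sum_nat_const card_bool mulnC; congr (_ * _).
  rewrite (_ : #|_| = #|~: [set i]|); last by apply: eq_card => j; rewrite !inE eq_sym.
  by rewrite cardsCs setCK cards1.
case: r Q3 => [|[|[|t]]] // _; rewrite subn1 /=; nia.
Qed.
End ConeStep.

(** * The two small base cases *)

Lemma extend_cone3 (I V : finType) (E : V -> V -> V -> bool) (f : I -> V) (p : V)
    (u0 u1 u2 u3 : option I) : indep_nbhs E ->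
  E (oapp f p u0) (oapp f p u1) (oapp f p u2) -> E (oapp f p u0) (oapp f p u1) (oapp f p u3) ->
  E (oapp f p u0) (oapp f p u2) (oapp f p u3) -> extend_hom (@cone_pat (option bool)) E f p.
Proof.
move=> HE E1 E2 E3; have C23 := adjC23 HE.
apply: (@extend_cone _ _ E f p HE _ u0
  (fun o => if o is Some b then if b then u3 else u2 else u1)).
by move=> [[]|] [[]|] //= _; rewrite // C23.
Qed.

Lemma sum_option (T : finType) (F : option T -> nat) :
  \sum_o F o = F None + \sum_t F (Some t).
Proof.
rewrite (bigD1 None) //=; congr (_ + _).
rewrite (reindex_omap Some id) => [|[t|]] //=.
by apply: eq_bigl => t; rewrite eqxx.
Qed.

Ltac all_b H := move: (H true) (H false).
Ltac all_i H := move: (H None) (H (Some true)) (H (Some false)).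
Ltac all_ib H := all_b (H None); all_b (H (Some true)); all_b (H (Some false)).

(** The first hypothesis says that [p] forms at most one edge with the pairs of a transversal: two
    such edges and the transversal make a cone over three vertices. Several links tie at 18: all
    [xz] pairs with two [xx] pairs, or a perfect [yz] matching with [yy] and [zz]. *)
Lemma triple_link_bound (xy xz : option bool -> bool -> nat) (yz : bool -> bool -> nat)
    (xx yy zz : nat) :
  (forall i b c, xy i b + xz i c + yz b c <= 1) ->
  xx <= 2 -> yy <= 1 -> zz <= 1 ->
  xx = 0 \/ (forall b c, yz b c = 0) ->
  yy = 0 \/ [/\ forall i c, xz i c = 0, forall i, xy i true + xy i false <= 1 &
               forall c, yz true c + yz false c <= 1] ->
  zz = 0 \/ [/\ forall i b, xy i b = 0, forall i, xz i true + xz i false <= 1 &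
               forall b, yz b true + yz b false <= 1] ->
  2 * (\sum_i \sum_b xy i b) + 2 * (\sum_i \sum_c xz i c) + 3 * (\sum_b \sum_c yz b c)
  + 3 * xx + 6 * yy + 6 * zz <= 18.
Proof.
move=> T hx hy hz.
have S (F : option bool -> nat) : \sum_i F i = F None + (F (Some true) + F (Some false)).
  by rewrite sum_option big_bool.
rewrite !S !big_bool /=.
all_ib (fun i b => T i b true); all_ib (fun i b => T i b false).
have hX : (forall b c, yz b c = 0) ->
    [/\ yz true true = 0, yz true false = 0, yz false true = 0 & yz false false = 0].
  by move=> H; rewrite !H.
move=> ? ? ? ? ? ? ? ? ? ? ? ? [X|/hX[? ? ? ?]] [Y|[Y1 Y2 Y3]] [Z|[Z1 Z2 Z3]].
- lia.
- all_ib Z1; all_i Z2; all_b Z3; lia.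
- all_ib Y1; all_i Y2; all_b Y3; lia.
- all_ib Y1; all_i Y2; all_b Y3; all_ib Z1; all_i Z2; all_b Z3; lia.
- lia.
- all_ib Z1; all_i Z2; all_b Z3; lia.
- all_ib Y1; all_i Y2; all_b Y3; lia.
- all_ib Y1; all_i Y2; all_b Y3; all_ib Z1; all_i Z2; all_b Z3; lia.
Qed.

(** At most one pair of each opposite couple occurs and no three form a star, so three pairs form a
    triangle, which excludes all the [d]'s and weighs 45. With no transversal pair, the [d]'s alone
    give [3 * 10 + 5 * 3 = 45]. *)
Lemma quad_link_bound (c12 c13 c14 c23 c24 c34 d1 d2 d3 d4 : nat) :
  c12 + c34 <= 1 -> c13 + c24 <= 1 -> c14 + c23 <= 1 ->
  c12 + c13 + c14 <= 2 -> c12 + c23 + c24 <= 2 -> c13 + c23 + c34 <= 2 ->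
  c14 + c24 + c34 <= 2 ->
  d1 <= 5 -> d2 <= 1 -> d3 <= 1 -> d4 <= 1 ->
  d1 = 0 \/ [/\ c23 = 0, c24 = 0 & c34 = 0] -> d2 = 0 \/ [/\ c13 = 0, c14 = 0 & c34 = 0] ->
  d3 = 0 \/ [/\ c12 = 0, c14 = 0 & c24 = 0] -> d4 = 0 \/ [/\ c12 = 0, c13 = 0 & c23 = 0] ->
  15 * (c12 + c13 + c14 + c23 + c24 + c34) + 10 * (d2 + d3 + d4) + 3 * d1 <= 45.
Proof.
move=> ? ? ? ? ? ? ? ? ? ? ?.
case=> [?|[? ? ?]]; case=> [?|[? ? ?]]; case=> [?|[? ? ?]]; case=> [?|[? ? ?]]; lia.
Qed.

Section TripleStep.
Local Notation I := (option bool * option bool)%type.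
Let x i : I := (None, i).
Let y b : I := (Some true, Some b).
Let z c : I := (Some false, Some c).

(* A blow-up of an edge with parts of sizes 3, 2 and 2: each link without a copy of the
   three-vertex cone weighs at most 18, out of 57. *)
Definition triple_weights : seq (I * I * nat) :=
  [seq (x t.1, y t.2, 2) | t <- enum {: option bool * bool}] ++
  [seq (x t.1, z t.2, 2) | t <- enum {: option bool * bool}] ++
  [seq (y t.1, z t.2, 3) | t <- enum {: bool * bool}] ++
  [:: (x None, x (Some true), 3); (x None, x (Some false), 3);
      (x (Some true), x (Some false), 3); (y true, y false, 6); (z true, z false, 6)].

Lemma triple_weights_neq t : t \in triple_weights -> t.1.1 != t.1.2.
Proof.
rewrite !mem_cat => /or4P[/mapP[? _ ->]//|/mapP[? _ ->]//|/mapP[? _ ->]//|].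
by rewrite !inE => /orP[/eqP->|/orP[/eqP->|/orP[/eqP->|/orP[/eqP->|/eqP->]]]].
Qed.

Lemma sum_triple_weights (F : I -> I -> nat) :
  \sum_(t <- triple_weights) t.2 * F t.1.1 t.1.2 =
  2 * (\sum_i \sum_b F (x i) (y b)) + 2 * (\sum_i \sum_c F (x i) (z c)) +
  3 * (\sum_b \sum_c F (y b) (z c)) +
  3 * (F (x None) (x (Some true)) + F (x None) (x (Some false)) +
       F (x (Some true)) (x (Some false))) +
  6 * F (y true) (y false) + 6 * F (z true) (z false).
Proof.
rewrite !big_cat !big_map /= !big_cons big_nil /=.
rewrite -!big_distrr /= -!enumT !big_enum /= !pair_bigA /= !mulnDr !addnA addn0 //.
Qed.

Lemma triple_weights_total : 3 * 18 < \sum_(t <- triple_weights) t.2.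
Proof.
have := sum_triple_weights (fun _ _ => 1).
under eq_bigr => t _ do rewrite muln1; move=> ->.
by rewrite !sum_option !big_bool.
Qed.

Variables (V : finType) (E : V -> V -> V -> bool) (f : I -> V) (p : V).
Hypotheses (HE : indep_nbhs E) (fE : blown_hom (@cone_pat bool) E f).

Let Exyz i b c : E (f (x i)) (f (y b)) (f (z c)).
Proof. exact: fE. Qed.

Lemma triple_pointwise :
  link_weight E triple_weights f p <= 18 \/ extend_hom (@cone_pat (option bool)) E f p.
Proof.
have C12 := adjC12 HE; have C23 := adjC23 HE; have ind := adj_indep HE.
have [/existsP[s Hs]|no1] := boolP [exists s : {ffun option (option bool) -> option I},
    pat_hom (@cone_pat (option bool)) E (fun j => oapp f p (s j))].
  by right; exists s.
left; have no u0 u1 u2 u3 : E (oapp f p u0) (oapp f p u1) (oapp f p u2) ->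
    E (oapp f p u0) (oapp f p u1) (oapp f p u3) ->
    E (oapp f p u0) (oapp f p u2) (oapp f p u3) -> False.
  move=> E1 E2 E3; have [s Hs] := extend_cone3 HE E1 E2 E3.
  by move/existsPn/(_ s): no1; rewrite Hs.
rewrite /link_weight (sum_triple_weights (fun u v => E p (f u) (f v))).
(* In [noL] the new vertex is the apex of the forbidden cone; in [no2] it is a base vertex under the
   apex [u]. *)
have noL u v w : E p (f u) (f v) -> E p (f u) (f w) -> E p (f v) (f w) -> False.
  by apply: (no None (Some u) (Some v) (Some w)).
have no2 u v w : E (f u) (f v) (f w) -> E p (f u) (f v) -> E p (f u) (f w) -> False.
  move=> E0 E1 E2; apply: (no (Some u) None (Some v) (Some w)) => //=; by rewrite C12.
have rot u v w : E u v w -> E v w u by rewrite (adj_rot u v w HE).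
have nand (a b : bool) : (a -> b -> False) -> a + b <= 1.
  by case: a; case: b => // /(_ isT isT).
have tri (a b c : bool) : (a -> b -> False) -> (a -> c -> False) -> (b -> c -> False) ->
    a + b + c <= 1.
  by case: a; case: b; case: c => // H1 H2 H3;
    first [case: (H1 isT isT) | case: (H2 isT isT) | case: (H3 isT isT)].
have XX i j b c : E p (f (x i)) (f (x j)) -> E p (f (y b)) (f (z c)) = false.
  move=> l; apply/negP => l'; have := ind (f (y b)) (f (z c)) p (f (x i)) (f (x j)).
  by rewrite l => H; have := H (rot _ _ _ l') (rot _ _ _ (Exyz _ _ _)) (rot _ _ _ (Exyz _ _ _)).
have YY i c : E p (f (y true)) (f (y false)) -> E p (f (x i)) (f (z c)) = false.
  move=> l; apply/negP => l'; have := ind (f (x i)) (f (z c)) p (f (y true)) (f (y false)).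
  rewrite l => H; have := H (rot _ _ _ l'); rewrite !(C23 _ (f (z c))) => K.
  by have := K (Exyz _ _ _) (Exyz _ _ _).
have ZZ i b : E p (f (z true)) (f (z false)) -> E p (f (x i)) (f (y b)) = false.
  move=> l; apply/negP => l'; have := ind (f (x i)) (f (y b)) p (f (z true)) (f (z false)).
  by rewrite l => H; have := H (rot _ _ _ l') (Exyz _ _ _) (Exyz _ _ _).
apply: (@triple_link_bound (fun i b => E p (f (x i)) (f (y b)))
  (fun i c => E p (f (x i)) (f (z c))) (fun b c => E p (f (y b)) (f (z c)))).
- move=> i b c; have e := Exyz i b c; apply: tri => l1 l2.
  + exact: no2 e l1 l2.
  + by apply: (no2 (y b) (x i) (z c)) => //; [rewrite C12 | rewrite C23].
  + by apply: (no2 (z c) (x i) (y b)); [rewrite C12 C23 | rewrite C23 | rewrite C23].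
- move: (noL (x None) (x (Some true)) (x (Some false))).
  by do 3 case: (E p _ _) => //; move=> /(_ isT isT isT).
- exact: leq_b1.
- exact: leq_b1.
- have [l|n1] := boolP (E p (f (x None)) (f (x (Some true)))).
    by right=> b c; rewrite (XX _ _ _ _ l).
  have [l|n2] := boolP (E p (f (x None)) (f (x (Some false)))).
    by right=> b c; rewrite (XX _ _ _ _ l).
  have [l|n3] := boolP (E p (f (x (Some true))) (f (x (Some false)))).
    by right=> b c; rewrite (XX _ _ _ _ l).
  by left.
- have [l|n1] := boolP (E p (f (y true)) (f (y false))); [right|by left].
  split=> [i c|i|c]; first by rewrite YY.
    by apply: nand => l1 l2; apply: (noL (y true) (y false) (x i)) => //; rewrite C23.
  by apply: nand => l1 l2; apply: (noL (y true) (y false) (z c)).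
- have [l|n1] := boolP (E p (f (z true)) (f (z false))); [right|by left].
  split=> [i c|i|c]; first by rewrite ZZ.
    by apply: nand => l1 l2; apply: (noL (z true) (z false) (x i)) => //; rewrite C23.
  by apply: nand => l1 l2; apply: (noL (z true) (z false) (y c)) => //; rewrite C23.
Qed.
End TripleStep.

Section QuadStep.
Local Notation I := (K4 * K4)%type.
Let k1 : K4 := None.
Let k2 : K4 := Some None.
Let k3 : K4 := Some (Some true).
Let k4 : K4 := Some (Some false).

(* One transversal of a blow-up of [K4], four copies of the first vertex and two of each
   other one: each link in which the four copies are not a clique weighs at most 45,
   out of 138. *)
Definition quad_weights : seq (I * I * nat) :=
  [seq (t, 15) | t <- [:: ((k1, k1), (k2, k1)); ((k1, k1), (k3, k1)); ((k1, k1), (k4, k1));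
      ((k2, k1), (k3, k1)); ((k2, k1), (k4, k1)); ((k3, k1), (k4, k1))]] ++
  [seq (t, 10) | t <- [:: ((k2, k1), (k2, k2)); ((k3, k1), (k3, k2)); ((k4, k1), (k4, k2))]] ++
  [seq (t, 3) | t <- [:: ((k1, k1), (k1, k2)); ((k1, k1), (k1, k3)); ((k1, k1), (k1, k4));
      ((k1, k2), (k1, k3)); ((k1, k2), (k1, k4)); ((k1, k3), (k1, k4))]].

Lemma quad_weights_neq t : t \in quad_weights -> t.1.1 != t.1.2.
Proof. by move: t; apply/allP. Qed.

Lemma quad_weights_total : 3 * 45 < \sum_(t <- quad_weights) t.2.
Proof. by rewrite /quad_weights !big_cons big_nil. Qed.

Lemma sum_quad_weights (F : I -> I -> nat) :
  \sum_(t <- quad_weights) t.2 * F t.1.1 t.1.2 =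
  15 * (F (k1, k1) (k2, k1) + F (k1, k1) (k3, k1) + F (k1, k1) (k4, k1) +
    F (k2, k1) (k3, k1) + F (k2, k1) (k4, k1) + F (k3, k1) (k4, k1)) +
  10 * (F (k2, k1) (k2, k2) + F (k3, k1) (k3, k2) + F (k4, k1) (k4, k2)) +
  3 * (F (k1, k1) (k1, k2) + F (k1, k1) (k1, k3) + F (k1, k1) (k1, k4) +
    F (k1, k2) (k1, k3) + F (k1, k2) (k1, k4) + F (k1, k3) (k1, k4)).
Proof.
rewrite !big_cat !big_map -!big_distrr /= !big_cons !big_nil.
by rewrite !addn0 !addnA.
Qed.

Variables (V : finType) (E : V -> V -> V -> bool) (f : I -> V) (p : V).
Hypotheses (HE : indep_nbhs E) (fE : blown_hom (@complete_pat K4) E f).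

Lemma quad_pointwise :
  link_weight E quad_weights f p <= 45 \/ extend_hom (@cone_pat K4) E f p.
Proof.
have C12 := adjC12 HE; have C23 := adjC23 HE; have ind := adj_indep HE.
have [/existsP[s Hs]|no1] := boolP [exists s : {ffun option K4 -> option I},
    pat_hom (@cone_pat K4) E (fun j => oapp f p (s j))].
  by right; exists s.
left; pose l u v := E p (f u) (f v).
have no : ~ (forall i j : K4, i != j -> l (k1, i) (k1, j)).
  move=> H; have [s Hs] := @extend_cone _ _ E f p HE K4 None (fun i => Some (k1, i)) H.
  by move/existsPn/(_ s): no1; rewrite Hs.
have rot u v w : E u v w -> E v w u by rewrite (adj_rot u v w HE).
have nand (a b : bool) : (a -> b -> False) -> a + b <= 1.
  by case: a; case: b => // /(_ isT isT).
have diag a b c i j k m : complete_pat a b c -> l (a, i) (a, j) -> l (b, k) (c, m) = false.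
  rewrite /complete_pat /= !inE !negb_or andbT => /andP[/andP[ab ac] bc] l1; apply/negP => l2.
  have e n : E (f (b, k)) (f (c, m)) (f (a, n)).
    by apply: fE; rewrite /complete_pat /= !inE negb_or bc eq_sym ab eq_sym ac.
  by have := ind _ _ _ _ _ (rot _ _ _ l2) (e i) (e j); rewrite -/(l _ _) l1.
have opp a b c d : complete_pat a b c -> complete_pat a b d ->
    l (a, k1) (b, k1) + l (c, k1) (d, k1) <= 1.
  move=> e1 e2; apply: nand => l1 l2.
  by have := ind _ _ _ _ _ (rot _ _ _ l1) (fE k1 k1 k1 e1) (fE k1 k1 k1 e2); rewrite -/(l _ _) l2.
have star a b c d : complete_pat b c d ->
    l (a, k1) (b, k1) + l (a, k1) (c, k1) + l (a, k1) (d, k1) <= 2.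
  move=> e; have := ind p (f (a, k1)) (f (b, k1)) (f (c, k1)) (f (d, k1)).
  rewrite (fE k1 k1 k1 e) /l.
  by do 3 case: (E p _ _) => //; move=> /(_ isT isT isT).
have lC u v : l u v = l v u by rewrite /l C23.
rewrite /link_weight (sum_quad_weights (fun u v => l u v)).
pose d1 := l (k1, k1) (k1, k2) + l (k1, k1) (k1, k3) + l (k1, k1) (k1, k4) +
  l (k1, k2) (k1, k3) + l (k1, k2) (k1, k4) + l (k1, k3) (k1, k4).
have bool0 (b : bool) (P : Prop) : (b -> P) -> (b : nat) = 0 \/ P.
  by case: b => H; [right; apply: H | left].
  apply: quad_link_bound; try exact: opp; try exact: star; try exact: leq_b1.
  - by rewrite (lC (k1, k1) (k2, k1)); apply: star.
  - by rewrite (lC (k1, k1) (k3, k1)) (lC (k2, k1) (k3, k1)); apply: star.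
  - rewrite (lC (k1, k1) (k4, k1)) (lC (k2, k1) (k4, k1)) (lC (k3, k1) (k4, k1)).
    exact: star.
  - rewrite -/d1 leqNgt; apply/negP => d6; apply: no.
    have H : [&& l (k1, k1) (k1, k2), l (k1, k1) (k1, k3), l (k1, k1) (k1, k4),
        l (k1, k2) (k1, k3), l (k1, k2) (k1, k4) & l (k1, k3) (k1, k4)].
      by move: d6; rewrite /d1; do 6 case: (l _ _).
    case/and5P: H => h1 h2 h3 h4 /andP[h5 h6].
    by move=> [[[]|]|] [[[]|]|] // _; rewrite // lC.
  - rewrite -/d1; have [->|d0] := posnP d1; [by left|right].
    have [i [j lij]] : exists i j, l (k1, i) (k1, j).
      move: d0; rewrite /d1.
      case h1: (l _ (k1, k2)); first by exists k1, k2.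
      case h2: (l (k1, k1) (k1, k3)); first by exists k1, k3.
      case h3: (l (k1, k1) (k1, k4)); first by exists k1, k4.
      case h4: (l (k1, k2) (k1, k3)); first by exists k2, k3.
      case h5: (l (k1, k2) (k1, k4)); first by exists k2, k4.
      by case h6: (l (k1, k3) (k1, k4)) => // _; exists k3, k4.
    by split; rewrite (diag k1 _ _ i j).
  - by apply: bool0 => h; split; rewrite (diag k2 _ _ k1 k2).
  - by apply: bool0 => h; split; rewrite (diag k3 _ _ k1 k2).
  - by apply: bool0 => h; split; rewrite (diag k4 _ _ k1 k2).
Qed.
End QuadStep.

(** * Counting in sets, and hypergraphs as relations *)

Definition nbh (V : finType) (E : V -> V -> V -> bool) (x y : V) : {set V} := [set z | E x y z].

Lemma sum_card_sym (S T : finType) (A : {set S}) (B : {set T}) (r : S -> T -> bool) :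
  (\sum_(a in A) #|[set b in B | r a b]| = \sum_(b in B) #|[set a in A | r a b]|)%N.
Proof.
under eq_bigr => a _ do rewrite -sum1_card.
under [RHS]eq_bigr => b _ do rewrite -sum1_card.
rewrite (exchange_big_dep (mem B)) /= => [|a b _]; last by rewrite inE => /andP[].
apply: eq_bigr => b bB; apply: eq_bigl => a.
by rewrite !inE bB; case: (a \in A).
Qed.

Definition off_diag (V : finType) (X : {set V}) : {set V * V} :=
  [set q | [&& q.1 \in X, q.2 \in X & q.1 != q.2]].

Lemma card_off_diag (V : finType) (X : {set V}) : #|off_diag X| = (#|X| * #|X|.-1)%N.
Proof.
rewrite -sum1_card (eq_bigl (fun q => (q.1 \in X) && (q.2 \in X :\ q.1))).
  rewrite -(pair_big_dep (mem X) (fun a b => b \in X :\ a) (fun _ _ => 1%N)) /=.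
  rewrite -sum_nat_const; apply: eq_bigr => u uX; rewrite sum1_card.
  by rewrite [in RHS](cardsD1 u) uX.
by move=> q; rewrite !inE [q.2 == _]eq_sym [(q.2 \in X) && _]andbC.
Qed.

Lemma card_sum_in (V : finType) (S : {set V}) : #|S| = (\sum_v (v \in S))%N.
Proof. by rewrite -sum1_card big_mkcond; apply: eq_bigr => v _; case: (v \in S). Qed.

Lemma card_sum_type (V : finType) : #|V| = (\sum_(v : V) 1)%N.
Proof. by rewrite sum1_card. Qed.

(** Vertex by vertex: membership in the three sets [A], [B] and the union of [D] and [D'] is at most
    one plus the number of pairwise overlaps. If the three nearly partition [V], then [D] can barely
    exceed [D']. *)
Lemma card_near (V : finType) (A B D D' : {set V}) :
  (#|D :\: D'| + #|A| + #|B| + #|D'| <= #|V| + #|A :&: B| + #|D :&: A| + #|D :&: B|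
     + #|D' :&: A| + #|D' :&: B|)%N.
Proof.
rewrite card_sum_type !card_sum_in -!big_split /=; apply: leq_sum => v _.
by rewrite !inE; case: (v \in A); case: (v \in B); case: (v \in D); case: (v \in D').
Qed.

Definition adj (V : finType) (G : graph3 V) (x y z : V) : bool := [set x; y; z] \in edges G.

Section Adjacency.
Variables (V : finType) (G : graph3 V).

Lemma card_edge e : e \in edges G -> #|e| = 3.
Proof. by move=> eG; apply/eqP; apply: (forall_inP (edgesP G)). Qed.

Lemma cards3 (x y z : V) : (#|[set x; y; z]| == 3) = uniq [:: x; y; z].
Proof.
rewrite setUC cardsU1 cards2 /= !inE !negb_or andbT.
rewrite [z == x]eq_sym [z == y]eq_sym.
by case: (x == y); case: (x == z); case: (y == z).
Qed.

Lemma edge_set3 (e : {set V}) : #|e| = 3 -> exists x y z, e = [set x; y; z] /\ uniq [:: x; y; z].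
Proof.
move=> e3; have: 2 < #|e| by rewrite e3.
case/card_gt2P => x [y [z [[xe ye ze] [xy yz zx]]]]; exists x, y, z.
have u : uniq [:: x; y; z] by rewrite /= !inE negb_or xy yz eq_sym zx.
have c : #|[set x; y; z]| = 3 by apply/eqP; rewrite cards3.
split=> //; apply/esym/eqP; rewrite eqEcard e3 c andbT.
by apply/subsetP => t; rewrite !inE => /orP[/orP[]|] /eqP->.
Qed.

Lemma adj_uniq x y z : adj G x y z -> uniq [:: x; y; z].
Proof. by move=> /card_edge/eqP; rewrite cards3. Qed.

Lemma adj_indep_nbhs : F32_free G -> indep_nbhs (adj G).
Proof.
move=> free; split.
- by move=> x y z; rewrite /adj [[set x; y]]setUC.
- by move=> x y z; rewrite /adj -!setUA [[set y] :|: _]setUC.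
- by move=> x y; apply/negP => /adj_uniq; rewrite /= !inE eqxx.
move=> x y a b c xa xb xc; apply/negP => abc; apply/negP: free; rewrite negbK.
have := adj_uniq xa; have := adj_uniq xb; have := adj_uniq xc; have := adj_uniq abc.
rewrite /= !inE !negb_or !andbT => /andP[/andP[ab ac] bc] /andP[/andP[xy xc'] yc].
move=> /andP[/andP[_ xb'] yb] /andP[/andP[_ xa'] ya].
pose g (i : 'I_5) := nth x [:: x; y; a; b; c] i.
apply/existsP; exists (finfun g); apply/andP; split.
  apply/injectiveP => i j; rewrite !ffunE => /eqP.
  rewrite nth_uniq ?size_seq //= ?ltn_ord //;
    last by rewrite !inE !negb_or xy xa' xb' xc' ya yb yc ab ac bc.
  by move=> /eqP/val_inj.
apply/forall_inP => e; rewrite inE => /andP[_]; rewrite !inE.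
have im (i j k : nat) : i < 5 -> j < 5 -> k < 5 ->
    finfun g @: [set inord i; inord j; inord k] =
    [set nth x [:: x; y; a; b; c] i; nth x [:: x; y; a; b; c] j; nth x [:: x; y; a; b; c] k].
  by move=> i5 j5 k5; rewrite !imsetU !imset_set1 !ffunE /g !inordK.
by case/orP => [/orP[/orP[]|]|] /eqP->; rewrite im.
Qed.

Lemma codegree_le x y : x != y -> codegree G x y <= #|[pred z | adj G x y z]|.
Proof.
move=> xy; rewrite -cardsE; apply: leq_trans (leq_imset_card (fun z => [set x; y; z]) _).
apply: subset_leq_card; apply/subsetP => e; rewrite inE => /andP[eG /andP[xe ye]].
have sub : [set x; y] \subset e by apply/subsetP => t; rewrite !inE => /orP[] /eqP->.
have: 0 < #|e :\: [set x; y]|.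
  by rewrite cardsD (setIidPr sub) cards2 xy (card_edge eG).
case/card_gt0P => z; rewrite !inE negb_or => /andP[/andP[zx zy] ze].
have E : e = [set x; y; z].
  have c : #|[set x; y; z]| = 3.
    by apply/eqP; rewrite cards3 /= !inE negb_or xy eq_sym zx eq_sym zy.
  apply/esym/eqP; rewrite eqEcard card_edge // c andbT.
  by apply/subsetP => t; rewrite !inE => /orP[/orP[]|] /eqP->.
by apply/imsetP; exists z => //; rewrite !inE /= /adj -E.
Qed.

End Adjacency.

Lemma bigminn_leq (I : finType) (n : nat) (P : pred I) (F : I -> nat) (i : I) :
  P i -> \big[minn/n]_(j | P j) F j <= F i.
Proof.
move=> Pi; have := mem_index_enum i; elim: (index_enum I) => // j s IH.
rewrite inE big_cons => /orP[/eqP<-|/IH h]; first by rewrite Pi geq_minl.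
by case: ifP => // _; apply: leq_trans (geq_minr _ _) h.
Qed.

Lemma edit_distance_le (V : finType) (G H : graph3 V) : edit_distance G H <= #|edits G H|.
Proof.
apply: bigminn_leq; apply/existsP; exists [ffun x => x]; apply/and3P; split.
- by apply/injectiveP => x y; rewrite !ffunE.
- by apply/eqP; rewrite -[RHS]imset_id; apply: eq_imset => x; rewrite ffunE.
- apply/eqP; rewrite -[RHS]imset_id; apply: eq_imset => e /=.
  by rewrite -[RHS]imset_id; apply: eq_imset => x; rewrite ffunE.
Qed.

Lemma exists_subset (V : finType) (S : {set V}) (k : nat) : k <= #|S| ->
  exists2 X : {set V}, X \subset S & #|X| = k.
Proof.
elim: k => [|k IH] kS; first by exists set0; rewrite ?sub0set ?cards0.
have [X XS Xk] := IH (ltnW kS).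
have: 0 < #|S :\: X| by have := cardsID X S; rewrite (setIidPr XS) Xk; lia.
case/card_gt0P => x; rewrite inE => /andP[xX xS]; exists (x |: X).
  by rewrite subUset sub1set xS.
by rewrite cardsU1 xX Xk.
Qed.

Lemma card_set3I (V : finType) (x y z : V) (S : {set V}) : uniq [:: x; y; z] ->
  #|[set x; y; z] :&: S| = ((x \in S) + (y \in S) + (z \in S))%N.
Proof.
rewrite /= !inE negb_or andbT => /andP[/andP[xy xz] yz].
rewrite card_sum_in (bigD1 x) //= (bigD1 y) 1?eq_sym //= (bigD1 z) /=; last first.
  by rewrite [z == x]eq_sym xz [z == y]eq_sym yz.
rewrite !inE !eqxx !orbT /= big1 ?addn0 ?addnA // => t /andP[/andP[tx ty] tz].
by rewrite !inE (negPf tx) (negPf ty) (negPf tz).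
Qed.

Lemma set3C12 (V : finType) (x y z : V) : [set x; y; z] = [set y; x; z].
Proof. by rewrite [[set x; y]]setUC. Qed.

Lemma set3C23 (V : finType) (x y z : V) : [set x; y; z] = [set x; z; y].
Proof. by rewrite -!setUA [[set y] :|: _]setUC. Qed.

(** * Covering the edited triples by ordered wrong triples *)

Section Edits.
Variables (V : finType) (G : graph3 V) (A B C A1 B1 C1 A0 B0 C0 : {set V}).
Hypotheses (AB : [disjoint A & B]) (BC : [disjoint B & C]) (CA : [disjoint C & A]).
Hypotheses (AB0 : [disjoint A0 & B0]) (BC0 : [disjoint B0 & C0]) (CA0 : [disjoint C0 & A0]).
Hypotheses (A1A : A1 \subset A) (B1B : B1 \subset B) (C1C : C1 \subset C).
Hypotheses (A1A0 : A1 \subset A0) (B1B0 : B1 \subset B0) (C1C0 : C1 \subset C0).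

Local Notation E := (adj G).
Let rest := ~: (A1 :|: B1 :|: C1).

Definition wrong_pairs (X Y : {set V}) : {set V * V * V} :=
  [set t | (t.1 \in off_diag X) && (E t.1.1 t.1.2 t.2 != (t.2 \in Y))].

(** Only one ordering of each edited 3-set has to appear, so it is enough to let the first
    coordinate be in [rest], or the first two share a class, or the classes come in the order [A1],
    [B1], [C1]. *)
Definition wrong_triples : {set V * V * V} :=
  [set t | t.1.1 \in rest] :|: (wrong_pairs A1 B :|: wrong_pairs B1 C :|: wrong_pairs C1 A) :|:
  [set t | [&& t.1.1 \in A1, t.1.2 \in B1, t.2 \in C1 & E t.1.1 t.1.2 t.2]].

Let inA v : v \in A1 ->
  ((v \in A0) * (v \in B0 = false) * (v \in C0 = false)) *
  ((v \in A) * (v \in B = false) * (v \in C = false)).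
Proof.
move=> h; have a := subsetP A1A _ h; have a0 := subsetP A1A0 _ h.
by rewrite a a0 (disjointFr AB a) (disjointFl CA a) (disjointFr AB0 a0) (disjointFl CA0 a0).
Qed.

Let inB v : v \in B1 ->
  ((v \in A0 = false) * (v \in B0) * (v \in C0 = false)) *
  ((v \in A = false) * (v \in B) * (v \in C = false)).
Proof.
move=> h; have a := subsetP B1B _ h; have a0 := subsetP B1B0 _ h.
by rewrite a a0 (disjointFl AB a) (disjointFr BC a) (disjointFl AB0 a0) (disjointFr BC0 a0).
Qed.

Let inC v : v \in C1 ->
  ((v \in A0 = false) * (v \in B0 = false) * (v \in C0)) *
  ((v \in A = false) * (v \in B = false) * (v \in C)).
Proof.
move=> h; have a := subsetP C1C _ h; have a0 := subsetP C1C0 _ h.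
by rewrite a a0 (disjointFr CA a) (disjointFl BC a) (disjointFr CA0 a0) (disjointFl BC0 a0).
Qed.

Let in_rest v : v \notin rest -> [\/ v \in A1, v \in B1 | v \in C1].
Proof.
rewrite !inE negbK => /orP[/orP[]|] h; [exact: Or31 | exact: Or32 | exact: Or33].
Qed.

Let in_edits x y z : uniq [:: x; y; z] ->
  ([set x; y; z] \in edits G (T A0 B0 C0)) = (E x y z != ([set x; y; z] \in edges (T A0 B0 C0))).
Proof.
by move=> _; rewrite /edits in_setU !in_setD /adj; do 2 case: (_ \in edges _).
Qed.

Let in_T x y z : uniq [:: x; y; z] -> ([set x; y; z] \in edges (T A0 B0 C0)) =
  let nA := ((x \in A0) + (y \in A0) + (z \in A0))%N in
  let nB := ((x \in B0) + (y \in B0) + (z \in B0))%N in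
  let nC := ((x \in C0) + (y \in C0) + (z \in C0))%N in
  [|| (nA == 2) && (nB == 1), (nB == 2) && (nC == 1) | (nC == 2) && (nA == 1)]%N.
Proof. by move=> u; rewrite inE /= cards3 u /= !card_set3I. Qed.

Let covered (e : {set V}) := exists2 t, t \in wrong_triples & e = [set t.1.1; t.1.2; t.2].

Let covered_rest x y z : x \in rest -> covered [set x; y; z].
Proof. by move=> h; exists (x, y, z) => //; rewrite !in_setU inE h. Qed.

(** Outside [rest], the approximate classes [A], [B], [C] and the balanced ones [A0], [B0], [C0]
    agree, so for a pair in one class the test against the next class is the test against
    [T A0 B0 C0]. *)
Let covered_pair x y z : uniq [:: x; y; z] -> [set x; y; z] \in edits G (T A0 B0 C0) ->
  z \notin rest ->
  [\/ (x \in A1) && (y \in A1), (x \in B1) && (y \in B1) | (x \in C1) && (y \in C1)] ->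
  covered [set x; y; z].
Proof.
move=> u; rewrite in_edits // in_T // => ed zr H; exists (x, y, z) => //.
have xy : x != y by move: u; rewrite /= !inE negb_or => /andP[/andP[]].
rewrite !in_setU; apply/orP; left; apply/orP; right; rewrite /wrong_pairs !in_set /= xy !andbT.
case: H => /andP[hx hy]; rewrite hx hy /=; move: ed.
- rewrite !(inA hx) !(inA hy); case: (in_rest zr) => hz.
  + by rewrite !(inA hz) /= => ->.
  + by rewrite !(inB hz) /= => ->.
  + by rewrite !(inC hz) /= => ->.
- rewrite !(inB hx) !(inB hy); case: (in_rest zr) => hz.
  + by rewrite !(inA hz) /= => ->; rewrite ?orbT.
  + by rewrite !(inB hz) /= => ->; rewrite ?orbT.
  + by rewrite !(inC hz) /= => ->; rewrite ?orbT.
- rewrite !(inC hx) !(inC hy); case: (in_rest zr) => hz.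
  + by rewrite !(inA hz) /= => ->; rewrite ?orbT.
  + by rewrite !(inB hz) /= => ->; rewrite ?orbT.
  + by rewrite !(inC hz) /= => ->; rewrite ?orbT.
Qed.

Let covered_rainbow x y z : uniq [:: x; y; z] -> [set x; y; z] \in edits G (T A0 B0 C0) ->
  x \in A1 -> y \in B1 -> z \in C1 -> covered [set x; y; z].
Proof.
move=> u; rewrite in_edits // in_T // => ed hx hy hz; exists (x, y, z) => //.
rewrite !in_setU !inE /= hx hy hz /=; move: ed.
by rewrite !(inA hx) !(inB hy) !(inC hz) /=; case: (E x y z) => //; rewrite orbT.
Qed.

Lemma edits_covered e : e \in edits G (T A0 B0 C0) -> covered e.
Proof.
move=> ed; have e3 : #|e| = 3%N.
  by move: ed; rewrite /edits in_setU !in_setD => /orP[]/andP[_ /card_edge].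
have [x [y [z [E1 u]]]] := edge_set3 e3; rewrite E1 in ed *; clear e e3 E1.
have [xr|xr] := boolP (x \in rest); first exact: covered_rest.
have [yr|yr] := boolP (y \in rest); first by rewrite set3C12; apply: covered_rest.
have [zr|zr] := boolP (z \in rest); first by rewrite set3C23 set3C12; apply: covered_rest.
have u1 : uniq [:: x; z; y] by rewrite -cards3 set3C23 cards3.
have u2 : uniq [:: y; z; x] by rewrite -cards3 set3C23 set3C12 cards3.
have u3 : uniq [:: y; x; z] by rewrite -cards3 set3C12 cards3.
have u4 : uniq [:: z; x; y] by rewrite -cards3 set3C12 set3C23 cards3.
have u5 : uniq [:: z; y; x] by rewrite -cards3 set3C12 set3C23 set3C12 cards3.
have E1 : [set x; y; z] = [set x; z; y] := set3C23 x y z.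
have E3 : [set x; y; z] = [set y; x; z] := set3C12 x y z.
have E2 : [set x; y; z] = [set y; z; x] by rewrite E3 set3C23.
have E4 : [set x; y; z] = [set z; x; y] by rewrite E1 set3C12.
have E5 : [set x; y; z] = [set z; y; x] by rewrite E2 set3C12.
have e1 := ed; have e2 := ed; have e3 := ed; have e4 := ed; have e5 := ed.
rewrite E1 in e1; rewrite E2 in e2; rewrite E3 in e3; rewrite E4 in e4; rewrite E5 in e5.
have pxy := covered_pair u ed zr; have pxz := covered_pair u1 e1 yr.
have pyz := covered_pair u2 e2 xr; rewrite -E1 in pxz; rewrite -E2 in pyz.
case: (in_rest xr) => hx; case: (in_rest yr) => hy; case: (in_rest zr) => hz;
  try (by apply: pxy; rewrite hx hy; first [exact: Or31 | exact: Or32 | exact: Or33]);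
  try (by apply: pxz; rewrite hx hz; first [exact: Or31 | exact: Or32 | exact: Or33]);
  try (by apply: pyz; rewrite hy hz; first [exact: Or31 | exact: Or32 | exact: Or33]).
- exact: covered_rainbow.
- by rewrite E1; apply: covered_rainbow.
- by rewrite E3; apply: covered_rainbow.
- by rewrite E4; apply: covered_rainbow.
- by rewrite E2; apply: covered_rainbow.
- by rewrite E5; apply: covered_rainbow.
Qed.

Lemma card_edits_le : (#|edits G (T A0 B0 C0)| <= #|wrong_triples|)%N.
Proof.
apply: leq_trans (leq_imset_card (fun t => [set t.1.1; t.1.2; t.2]) _).
apply: subset_leq_card; apply/subsetP => e /edits_covered[t tw ->].
by apply/imsetP; exists t.
Qed.

End Edits.

Import Order.TTheory GRing.Theory Num.Theory.
Local Open Scope ring_scope.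

(** * Supersaturation *)

Section Splice.
Variables (V I J : finType) (s : J -> I).
Implicit Types (f : {ffun I -> V}) (h : {ffun J -> V}).

Definition pull f : {ffun J -> V} := [ffun j => f (s j)].

Definition splice f h : {ffun I -> V} :=
  [ffun i => if [pick j | s j == i] is Some j then h j else f i].

Hypothesis s_inj : injective s.

Lemma spliceE f h j : splice f h (s j) = h j.
Proof.
rewrite ffunE; case: pickP => [k /eqP/s_inj->//|/(_ j)].
by rewrite eqxx.
Qed.

Lemma spliceN f h i : (forall j, s j != i) -> splice f h i = f i.
Proof.
by move=> Hi; rewrite ffunE; case: pickP => // j; rewrite (negPf (Hi j)).
Qed.

Lemma pull_splice f h : pull (splice f h) = h.
Proof. by apply/ffunP => j; rewrite ffunE spliceE. Qed.

Lemma splice_pull f h : splice (splice f h) (pull f) = f.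
Proof.
apply/ffunP => i; rewrite ffunE; case: pickP => [j /eqP<-|Hi].
  by rewrite ffunE.
by rewrite spliceN // => j; apply/negbT/Hi.
Qed.

(** Resampling the coordinates in the image of [s] preserves the uniform measure: exchanging the new
    values with the old ones is an involution on pairs [(f, h)]. *)
Lemma card_splice (A : pred {ffun I -> V}) :
  #|[pred t : {ffun I -> V} * {ffun J -> V} | A (splice t.1 t.2)]|
  = (#|[pred f | A f]| * #|{ffun J -> V}|)%N.
Proof.
pose g (t : {ffun I -> V} * {ffun J -> V}) := (splice t.1 t.2, pull t.1).
have gK : involutive g.
  by case=> f h; rewrite /g /= splice_pull pull_splice.
transitivity #|[predX [pred f | A f] & predT : pred {ffun J -> V}]|.
  rewrite -(card_image (inv_inj gK)); apply: eq_card => t.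
  apply/imageP/idP => [[u]|].
    by rewrite !inE => Au ->; rewrite /= Au.
  rewrite !inE andbT => At; exists (g t); last by rewrite gK.
  by rewrite inE /= splice_pull.
by rewrite cardX.
Qed.

Lemma card_pull (A : pred {ffun J -> V}) :
  (#|[pred f : {ffun I -> V} | A (pull f)]| * #|{ffun J -> V}|
   = #|{ffun I -> V}| * #|[pred h | A h]|)%N.
Proof.
rewrite -(card_splice (A \o pull)).
transitivity #|[predX predT : pred {ffun I -> V} & [pred h | A h]]|.
  by apply: eq_card => t; rewrite !inE /= pull_splice.
by rewrite cardX.
Qed.

End Splice.

Section Dense.
Variable R : realFieldType.
Implicit Types (c : R) (T : finType).

Definition dense c T (P : pred T) := c * #|T|%:R <= #|[pred t | P t]|%:R.

Lemma dense_le c c' T (P : pred T) : c' <= c -> dense c P -> dense c' P.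
Proof. by move=> cc'; apply: le_trans; rewrite ler_wpM2r. Qed.

Lemma dense_sub c T (P Q : pred T) : (forall t, P t -> Q t) -> dense c P -> dense c Q.
Proof.
move=> PQ /le_trans; apply; rewrite ler_nat; apply: subset_leq_card.
by apply/subsetP => t; rewrite !inE; apply: PQ.
Qed.

Lemma card_pair_dep (T U : finType) (P : T -> pred U) :
  #|[pred t : T * U | P t.1 t.2]| = (\sum_(t : T) #|[pred u | P t u]|)%N.
Proof.
under [RHS]eq_bigr => t _ do rewrite -sum1_card.
by rewrite pair_big_dep /= sum1_card; apply: eq_card.
Qed.

(** Fibres below [c / 2] account for at most half of the density; the rest needs a [c / 2] fraction
    of fibres of size at most [#|U|]. *)
Lemma dense_fiber c (T U : finType) (P : T -> pred U) : 0 <= c -> (0 < #|U|)%N ->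
  dense c (fun t : T * U => P t.1 t.2) ->
  dense (c / 2) (fun t : T => c / 2 * #|U|%:R <= #|[pred u | P t u]|%:R).
Proof.
move=> c0 U0; rewrite /dense card_prod natrM card_pair_dep.
set q : pred T := fun t => _.
rewrite (bigID q) /= natrD => H.
have H1 : ((\sum_(t | q t) #|[pred u | P t u]|)%N)%:R
          <= #|[pred t | q t]|%:R * #|U|%:R :> R.
  rewrite -natrM ler_nat -sum_nat_const.
  by apply: leq_sum => t _; apply: max_card.
have H2 : ((\sum_(t | ~~ q t) #|[pred u | P t u]|)%N)%:R
          <= #|T|%:R * (c / 2 * #|U|%:R) :> R.
  rewrite natr_sum; apply: le_trans (_ : \sum_(t | ~~ q t) c / 2 * #|U|%:R <= _).
    by apply: ler_sum => t; rewrite /q -ltNge => /ltW.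
  rewrite sumr_const -[X in X <= _]mulr_natl ler_wpM2r ?ler_nat ?max_card //.
  by rewrite mulr_ge0 // divr_ge0.
have U0' : 0 < #|U|%:R :> R by rewrite ltr0n.
rewrite -(ler_pM2r U0').
by nra.
Qed.

Lemma dense_pair a b (T U : finType) (q : pred T) (P : T -> pred U) : 0 <= b ->
  dense a q -> (forall t, q t -> b * #|U|%:R <= #|[pred u | P t u]|%:R) ->
  dense (a * b) (fun t : T * U => q t.1 && P t.1 t.2).
Proof.
move=> b0 aq qP; rewrite /dense card_prod natrM.
rewrite (card_pair_dep (fun t u => q t && P t u)).
rewrite (bigID q) /= natrD ler_wpDr ?ler0n //.
apply: le_trans (_ : #|[pred t | q t]|%:R * (b * #|U|%:R) <= _).
  by rewrite mulrACA ler_wpM2r // mulr_ge0.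
rewrite natr_sum mulr_natl -sumr_const ler_sum // => t; rewrite inE => qt.
by apply: le_trans (qP t qt) _; rewrite ler_nat; apply: subset_leq_card;
   apply/subsetP => u; rewrite !inE qt.
Qed.

Lemma dense_cover c (T K : finType) (P : pred T) (Q : K -> pred T) : 0 < c ->
  (forall t, P t -> exists k, Q k t) -> (0 < #|T|)%N -> dense c P ->
  exists k, dense (c / #|K|%:R) (Q k).
Proof.
move=> c0 PQ T0 dP; apply/existsP; rewrite -[X in is_true X]negbK; apply/negP => /existsPn H.
have K0 : (0 < #|K|)%N.
  have: (0 < #|[pred t | P t]|)%N.
    rewrite -(ltr0n R); apply: lt_le_trans dP.
    by rewrite mulr_gt0 // ltr0n.
  by case/card_gt0P => t; rewrite inE => /PQ[k _]; apply/card_gt0P; exists k.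
have: #|[pred t | P t]|%:R <= \sum_k #|[pred t | Q k t]|%:R :> R.
  rewrite -natr_sum ler_nat -sum1_card.
  under [leqRHS]eq_bigr => k _ do rewrite -sum1_card.
  rewrite (exchange_big_dep predT) //= [leqLHS]big_mkcond leq_sum // => t _.
  case: ifP => // /PQ[k Qk].
  by rewrite (bigD1 k).
apply/negP; rewrite -ltNge; apply: lt_le_trans dP.
apply: lt_le_trans (_ : \sum_(k : K) c / #|K|%:R * #|T|%:R <= _).
  have [k0 _] := card_gt0P K0.
  apply: ltr_sum => [|k _]; last by rewrite ltNge; apply: H.
  by apply/hasP; exists k0; rewrite ?mem_index_enum.
have K1 : #|K|%:R != 0 :> R by rewrite pnatr_eq0 -lt0n.
by rewrite sumr_const -(mulr_natr (_ * _) #|K|) mulrAC divfK.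
Qed.

Lemma dense_pull c (V I J : finType) (s : J -> I) (P : pred {ffun J -> V}) :
  injective s -> (0 < #|V|)%N ->
  dense c (fun f : {ffun I -> V} => P (pull s f)) <-> dense c P.
Proof.
move=> s_inj V0; have I0 (K : finType) : 0 < #|{ffun K -> V}|%:R :> R.
  by rewrite ltr0n card_ffun expn_gt0 V0.
have := card_pull s_inj P => /(congr1 (fun n => n%:R : R)); rewrite !natrM => E.
rewrite /dense -(ler_pM2r (I0 J)) E mulrAC [X in X <= _]mulrC.
by rewrite ler_pM2l.
Qed.

End Dense.

(** * Blow-ups of dense patterns *)

Section BlowUp.
Variable R : archiRealFieldType.

Section Selection.
Variables (V J K : finType) (k0 : K) (P : pred {ffun J -> V}).
Implicit Types (F : {ffun J * K -> V}) (s : {ffun J -> K}) (D : seq J).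

Definition select F s : {ffun J -> V} := [ffun j => F (j, s j)].

(** Interpolates between [P] on the [k0] copies alone ([D] empty) and the full blow-up, so that
    parts can be freed one at a time. *)
Definition partial_blowup D F :=
  [forall s : {ffun J -> K}, [forall j, (j \in D) || (s j == k0)] ==> P (select F s)].

(** Resample the value at [(i, k0)]. For a fraction [a / 2] of all [F], a fraction [a / 2] of the
    values is good, and each of the [#|K|] copies of [i] may be drawn independently from these. *)
Lemma dense_partial_blowup_cons (a : R) (i : J) D : 0 <= a -> (0 < #|V|)%N ->
  dense a (partial_blowup D) -> dense (a / 2 * (a / 2) ^+ #|K|) (partial_blowup (i :: D)).
Proof.
move=> a0 V0 dD.
pose s1 (_ : unit) := (i, k0); pose s2 (k : K) := (i, k).
have s1i : injective s1 by move=> [] [].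
have s2i : injective s2 by move=> k l [].
have n0 (L : finType) : 0 < #|{ffun L -> V}|%:R :> R.
  by rewrite ltr0n card_ffun expn_gt0 V0.
have := card_splice s1i (partial_blowup D) => /(congr1 (fun n => n%:R : R)).
rewrite natrM => E1.
have d1 : dense a (fun t : {ffun J * K -> V} * {ffun unit -> V} =>
                     partial_blowup D (splice s1 t.1 t.2)).
  by rewrite /dense E1 card_prod natrM mulrA ler_wpM2r.
have U0 : (0 < #|{ffun unit -> V}|)%N by rewrite -(ltr0n R).
have d2 := dense_fiber (P := fun F h => partial_blowup D (splice s1 F h)) a0 U0 d1.
have d3 := dense_pair (U := {ffun K -> V}) (b := (a / 2) ^+ #|K|)
  (P := fun F g => partial_blowup (i :: D) (splice s2 F g)) _ d2.
suff H : dense (a / 2 * (a / 2) ^+ #|K|)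
   (fun t : {ffun J * K -> V} * {ffun K -> V} => partial_blowup (i :: D) (splice s2 t.1 t.2)).
  move: H; rewrite /dense.
  have := card_splice s2i (partial_blowup (i :: D)) => /(congr1 (fun n => n%:R : R)).
  by rewrite natrM => ->; rewrite card_prod natrM mulrA ler_pM2r.
apply: dense_sub (d3 _ _) => [t /andP[]//| |F HF].
  by rewrite exprn_ge0 // divr_ge0.
pose S := [pred v | partial_blowup D (splice s1 F [ffun=> v])].
have S_card : a / 2 * #|V|%:R <= #|S|%:R.
  move: HF; rewrite card_ffun card_unit expn1 => /le_trans; apply; rewrite ler_nat.
  have inj : injective (fun h : {ffun unit -> V} => h tt).
    by move=> h h' E; apply/ffunP => -[].
  rewrite -(card_image inj); apply: subset_leq_card; apply/subsetP => v.
  case/imageP => h; rewrite !inE => Hh ->.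
  by congr (partial_blowup D (splice s1 F _)): Hh; apply/ffunP => -[]; rewrite ffunE.
apply: le_trans (_ : #|@ffun_on_mem K V (mem S)|%:R <= _).
  rewrite card_ffun_on card_ffun !natrX -exprMn lerXn2r ?nnegrE ?ler0n //.
  by rewrite mulr_ge0 // divr_ge0.
rewrite ler_nat; apply: subset_leq_card; apply/subsetP => g /ffun_onP gS.
rewrite inE; apply/forallP => s; apply/implyP => /forallP sD.
(* The copy chosen for [i] is a good value for position [(i, k0)], so the selection is judged with
   [i] reset to [k0], where only parts of [D] vary. *)
have := gS (s i); rewrite inE => /forallP /(_ [ffun j => if j == i then k0 else s j]).
have -> /= : [forall j, (j \in D) || ([ffun j => if j == i then k0 else s j] j == k0)].
  apply/forallP => j; rewrite ffunE; case: (altP (j =P i)) => [_|ji].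
    by rewrite eqxx orbT.
  by have := sD j; rewrite inE (negPf ji).
congr P; apply/ffunP => j; rewrite [LHS]ffunE [RHS]ffunE ffunE.
case: (altP (j =P i)) => [->|ji].
  by rewrite -[(i, k0)]/(s1 tt) (spliceE s1i) ffunE -[(i, s i)]/(s2 (s i)) (spliceE s2i).
by rewrite !spliceN //= => k; rewrite xpair_eqE (eq_sym i) (negPf ji).
Qed.

End Selection.

Lemma dense_blowup (J K : finType) (k0 : K) (c : R) : 0 < c ->
  exists2 c' : R, 0 < c' &
    forall (V : finType) (P : pred {ffun J -> V}), (0 < #|V|)%N -> dense c P ->
    dense c' (fun F : {ffun J * K -> V} => [forall s : {ffun J -> K}, P (select F s)]).
Proof.
move=> c0.
have [c' c'0 Hc'] : exists2 c' : R, 0 < c' &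
    forall (V : finType) (P : pred {ffun J -> V}), (0 < #|V|)%N -> dense c P ->
    dense c' (partial_blowup (K := K) k0 P (enum J)).
  elim: (enum J) => [|i D [c' c'0 IH]].
    exists c => // V P V0 dP.
    have s_inj : injective (fun j : J => (j, k0)) by move=> i j [].
    apply: dense_sub ((dense_pull (R := R) _ P s_inj V0).2 dP) => F PF.
    apply/forallP => s; apply/implyP => /forallP sD.
    move: PF; congr P; apply/ffunP => j; rewrite !ffunE.
    by move: (sD j) => /eqP->.
  exists (c' / 2 * (c' / 2) ^+ #|K|) => [|V P V0 dP].
    by rewrite mulr_gt0 ?exprn_gt0 // divr_gt0.
  by apply: dense_partial_blowup_cons => //; [exact: ltW | exact: IH].
exists c' => // V P V0 /(Hc' V P V0); apply: dense_sub => F /forallP PF.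
apply/forallP => s; apply: (implyP (PF s)).
by apply/forallP => j; rewrite mem_enum.
Qed.

Lemma card_collision (V I : finType) (u v : I) : u != v ->
  (#|[pred f : {ffun I -> V} | f u == f v]| * #|V| = #|{ffun I -> V}|)%N.
Proof.
move=> uv; pose s (_ : unit) := u.
have s_inj : injective s by move=> [] [].
have := card_splice s_inj (fun f : {ffun I -> V} => f u == f v).
rewrite [X in (_ * X)%N]card_ffun card_unit expn1 => <-.
rewrite (card_pair_dep (fun F h => splice s F h u == splice s F h v)).
rewrite -sum1_card; apply: eq_bigr => F _.
rewrite -(card1 ([ffun=> F v] : {ffun unit -> V})); apply: eq_card => h.
rewrite !inE -[u in LHS]/(s tt) (spliceE s_inj) spliceN; last by move=> ?; apply: uv.
by apply/eqP/eqP => [E|->]; [apply/ffunP => -[]; rewrite ffunE | rewrite ffunE].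
Qed.

Lemma ex_natr_ge (x : R) : exists n0, forall n, (n0 <= n)%N -> x <= n%:R.
Proof.
exists (Num.bound x) => n nx; have [x0|/ltW x0] := leP 0 x; last first.
  by apply: le_trans x0 _; rewrite ler0n.
by apply: le_trans (ltW (archi_boundP x0)) _; rewrite ler_nat.
Qed.

Lemma dense_injective (I : finType) (c : R) : 0 < c -> exists n0, forall (V : finType)
    (P : pred {ffun I -> V}), (n0 <= #|V|)%N -> (0 < #|V|)%N -> dense c P ->
  dense (c / 2) (fun f => P f && injectiveb f).
Proof.
(* A given pair of points collides with probability [1 / #|V|]; the union bound over the pairs of
   [I] must stay below [c / 2]. *)
move=> c0; have [n0 Hn0] := ex_natr_ge (2 * (#|I| * #|I|)%:R / c).
exists n0 => V P /Hn0 nV V0 dP.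
have V0' : 0 < #|V|%:R :> R by rewrite ltr0n.
have HV : (#|I| * #|I|)%:R <= c / 2 * #|V|%:R :> R.
  by move: nV; rewrite ler_pdivrMr //; lra.
pose N := #|{ffun I -> V}|.
have H1 : (#|[pred f : {ffun I -> V} | ~~ injectiveb f]| * #|V| <= #|I| * #|I| * N)%N.
  have -> : (#|I| * #|I| * N = \sum_(t : I * I) N)%N by rewrite sum_nat_const card_prod.
  apply: leq_trans (_ : (\sum_(t : I * I)
     (if t.1 != t.2 then #|[pred f : {ffun I -> V} | f t.1 == f t.2]| * #|V| else 0) <= _)%N).
    rewrite -big_mkcond -big_distrl /= leq_mul2r; apply/orP; right.
    rewrite -sum1_card; under [leqRHS]eq_bigr => t _ do rewrite -sum1_card.
    rewrite (exchange_big_dep predT) //= [leqLHS]big_mkcond leq_sum // => f _.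
    rewrite inE; case: ifP => // /injectivePn[u [v uv fuv]].
    by rewrite (bigD1 (u, v)) //= !inE uv fuv eqxx.
  by apply: leq_sum => t _; case: ifP => // tN; rewrite card_collision.
have H2 : #|[pred f : {ffun I -> V} | ~~ injectiveb f]|%:R <= c / 2 * N%:R :> R.
  rewrite -(ler_pM2r V0') -natrM.
  apply: le_trans (_ : (#|I| * #|I| * N)%:R <= _); first by rewrite ler_nat.
  by rewrite natrM mulrAC ler_wpM2r.
have H3 : (#|[pred f | P f]| <= #|[pred f | P f && injectiveb f]|
             + #|[pred f : {ffun I -> V} | ~~ injectiveb f]|)%N.
  rewrite -cardUI; apply: leq_trans (leq_addr _ _); apply: subset_leq_card.
  by apply/subsetP => f; rewrite !inE => ->; case: (injectiveb f).
move: dP H3; rewrite /dense -/N -(ler_nat R) natrD; move: H2.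
set a : R := _%:R; set b : R := _%:R; set d : R := _%:R; set e : R := _%:R; nra.
Qed.

End BlowUp.

Definition codegree_ge (R : realFieldType) (d : R) (V : finType) (E : V -> V -> V -> bool) :=
  forall x y, x != y -> d * #|V|%:R <= #|[pred z | E x y z]|%:R.

(** * Averaging the weight of links *)

Section Weights.
Variable R : archiRealFieldType.

Lemma dense_bij c (T U : finType) (g : T -> U) (P : pred U) : bijective g ->
  dense (R := R) c (fun t => P (g t)) <-> dense c P.
Proof.
move=> bg; rewrite /dense (bij_eq_card bg).
suff -> : #|[pred t | P (g t)]| = #|[pred u | P u]| by [].
rewrite -(card_image (bij_inj bg)); apply: eq_card => u.
apply/imageP/idP => [[t]|Pu]; first by rewrite inE => ? ->.
by case: bg => h gh hg; exists (h u); rewrite ?inE hg.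
Qed.

Lemma natr_bool_sum (T : finType) (A : pred T) : (\sum_(t : T) A t)%N = #|[pred t | A t]|.
Proof. by rewrite -sum1_card [RHS]big_mkcond; apply: eq_bigr => t _; rewrite inE; case: (A t). Qed.

(** Double counting of weighted pairs and common neighbours: each pair lies in at least [d * #|V|]
    links, while a link weighs at most [M] outside [A] and at most the total inside. *)
Lemma weight_many_heavy (I V : finType) (E : V -> V -> V -> bool)
    (ws : seq (I * I * nat)) (M : nat) (d : R) (f : I -> V) (A : pred V) :
  indep_nbhs E -> injective f -> codegree_ge d E ->
  (forall t, t \in ws -> t.1.1 != t.1.2) ->
  (forall p, (link_weight E ws f p <= M)%N \/ A p) ->
  ((\sum_(t <- ws) t.2)%:R * d - M%:R) * #|V|%:R
    <= (\sum_(t <- ws) t.2)%:R * #|[pred p | A p]|%:R.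
Proof.
move=> HE f_inj dE ws_neq HA; set W := (\sum_(t <- ws) t.2)%N.
have H1 : W%:R * d * #|V|%:R <= (\sum_p link_weight E ws f p)%:R.
  rewrite /link_weight exchange_big /= /W !natr_sum !mulr_suml.
  rewrite big_seq [leRHS]big_seq ler_sum // => t tws.
  rewrite -big_distrr natrM -mulrA ler_wpM2l ?ler0n //.
  have := dE (f t.1.1) (f t.1.2); rewrite (inj_eq f_inj) => /(_ (ws_neq t tws)).
  move=> /le_trans; apply.
  by rewrite (natr_bool_sum (fun p => E p (f t.1.1) (f t.1.2))) ler_nat
     subset_leq_card //; apply/subsetP => z; rewrite !inE (adj_rot z).
have H2 : (\sum_p link_weight E ws f p <= M * #|V| + W * #|[pred p | A p]|)%N.
  apply: leq_trans (_ : (\sum_p (M + W * A p) <= _)%N); last first.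
    by rewrite big_split /= sum_nat_const mulnC -big_distrr /= natr_bool_sum.
  apply: leq_sum => p _; case: (HA p) => [/leq_trans->//|Ap]; first exact: leq_addr.
  rewrite Ap muln1; apply: leq_trans (leq_addl _ _); apply: leq_sum => t _.
  by case: (E _ _ _); rewrite ?muln1 ?muln0.
move: H2; rewrite -(ler_nat R) natrD !natrM; lra.
Qed.

(** A single realised copy already forces [s] to be injective, since [pat] covers pairs; copies of
    [pat] are then a marginal of the maps on [option I]. *)
Lemma dense_extend c (I J V : finType) (pat : pattern J) (E : V -> V -> V -> bool)
    (s : {ffun J -> option I}) : 0 < c -> (0 < #|V|)%N -> indep_nbhs E -> covers_pairs pat ->
  dense (R := R) c (fun t : {ffun I -> V} * V => pat_hom pat E (fun j => oapp t.1 t.2 (s j))) ->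
  dense c (fun f : {ffun J -> V} => pat_hom pat E f).
Proof.
move=> c0 V0 HE cov d.
have [t Ht] : exists t : {ffun I -> V} * V, pat_hom pat E (fun j => oapp t.1 t.2 (s j)).
  have: (0 < #|[pred t : {ffun I -> V} * V | pat_hom pat E (fun j => oapp t.1 t.2 (s j))]|)%N.
    rewrite -(ltr0n R); apply: lt_le_trans d.
    by rewrite mulr_gt0 // ltr0n card_prod muln_gt0 V0 card_ffun expn_gt0 V0.
  by case/card_gt0P => t; rewrite inE; exists t.
have s_inj : injective s.
  by move=> i j sij; apply: (covers_inj HE cov Ht); rewrite sij.
apply/(dense_pull _ _ s_inj V0).
pose g (G : {ffun option I -> V}) := (pull Some G, G None).
have g_bij : bijective g.
  pose h (t : {ffun I -> V} * V) : {ffun option I -> V} := [ffun o => oapp t.1 t.2 o].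
  exists h => [G|[f p]].
    by apply/ffunP => -[i|]; rewrite ffunE //= ffunE.
  by rewrite /g ffunE; congr pair; apply/ffunP => i; rewrite !ffunE.
move/(dense_bij _ _ g_bij): d; apply: dense_sub => G; congr is_true.
by apply: eq_hom => j; rewrite ffunE; case: (s j) => //= i; rewrite ffunE.
Qed.

(* Averaging over [p] the weight of the pairs of a blow-up that lie in the link of [p]
   gives at least [(1 / 3 - d) * W > M], so a positive fraction of all [p] extend it. *)
Lemma weight_step (J J1 J2 K : finType) (pat : pattern J) (pat1 : pattern J1)
    (pat2 : pattern J2) (k0 : K) (ws : seq ((J * K) * (J * K) * nat)) (M : nat) :
  (forall a b c, pat a b c -> [/\ a != b, b != c & a != c]) ->
  covers_pairs pat1 -> covers_pairs pat2 ->
  (forall t, t \in ws -> t.1.1 != t.1.2) ->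
  (3 * M < \sum_(t <- ws) t.2)%N ->
  (forall (V : finType) (E : V -> V -> V -> bool) (f : J * K -> V) (p : V),
     indep_nbhs E -> blown_hom pat E f ->
     [\/ (link_weight E ws f p <= M)%N, extend_hom pat1 E f p | extend_hom pat2 E f p]) ->
  forall c : R, 0 < c -> exists (d c' : R) (n0 : nat), [/\ 0 < d, 0 < c' &
    forall (V : finType) (E : V -> V -> V -> bool), indep_nbhs E -> (n0 <= #|V|)%N ->
      codegree_ge (1 / 3 - d) E -> dense c (fun f : {ffun J -> V} => pat_hom pat E f) ->
      dense c' (fun f : {ffun J1 -> V} => pat_hom pat1 E f) \/
      dense c' (fun f : {ffun J2 -> V} => pat_hom pat2 E f)].
Proof.
move=> pat_neq cov1 cov2 ws_neq MW Hext c c0.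
set W := (\sum_(t <- ws) t.2)%N in MW.
have W0 : 0 < W%:R :> R by rewrite ltr0n; lia.
have [c1 c10 Hc1] := dense_blowup (R := R) J k0 c0.
have [n1 Hn1] := dense_injective (prod J K) c10.
pose e : R := 1 / (6 * W%:R).
have e0 : 0 < e by rewrite divr_gt0 // mulr_gt0.
pose L := ({ffun J1 -> option (J * K)} + {ffun J2 -> option (J * K)})%type.
pose c2 := c1 / 2 * e.
have c20 : 0 < c2 by rewrite mulr_gt0 // divr_gt0.
have L0 : 0 < #|{: L}|%:R + 1 :> R by rewrite ltr_wpDl ?ler0n.
exists (1 / (6 * W%:R)), (c2 / (#|{: L}|%:R + 1)), (maxn 1 n1); split => //.
  by rewrite divr_gt0.
move=> V E HE; rewrite geq_max => /andP[V0 nV] dE dP.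
have {}dP := Hn1 _ _ nV V0 (Hc1 _ _ V0 dP).
pose viol (f : {ffun J * K -> V}) (p : V) :=
  [exists s : {ffun J1 -> option (J * K)}, pat_hom pat1 E (fun j => oapp f p (s j))] ||
  [exists s : {ffun J2 -> option (J * K)}, pat_hom pat2 E (fun j => oapp f p (s j))].
have dV : dense c2 (fun t : {ffun J * K -> V} * V => viol t.1 t.2).
  apply: dense_sub (dense_pair (P := viol) (ltW e0) dP _) => [t /andP[]//|f].
  case/andP => /forallP fP /injectiveP f_inj.
  have fb : blown_hom pat E f.
    move=> a b c3 i j k abc; have [ab bc ac] := pat_neq _ _ _ abc.
    pose s : {ffun J -> K} := [ffun x => if x == a then i else if x == b then j else k].
    have /pat_homP/(_ _ _ _ abc) := fP s; rewrite !ffunE eqxx.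
    by rewrite eq_sym (negPf ab) eqxx eq_sym (negPf ac) eq_sym (negPf bc).
  have := @weight_many_heavy _ _ _ ws M _ f (viol f) HE f_inj dE ws_neq.
  have Hp p : (link_weight E ws f p <= M)%N \/ viol f p.
    case: (Hext V E f p HE fb) => Hs; [by left|right|right]; apply/orP.
      by left; apply/existsP.
    by right; apply/existsP.
  move=> /(_ Hp); rewrite -/W => H; rewrite -(ler_pM2l W0).
  apply: le_trans H; rewrite mulrA ler_wpM2r ?ler0n //.
  (* Integrality gives an excess of 1, so [W * (1 / 3 - 1 / (6 * W)) - M] is at least
     [1 / 3 - 1 / 6 = W * e]. *)
  have MW' : 3 * M%:R + 1 <= W%:R :> R by rewrite -natrM natr1 ler_nat.
  have -> : W%:R * e = 1 / 6 by rewrite /e; field; lra.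
  have -> : W%:R * (1 / 3 - 1 / (6 * W%:R)) = W%:R / 3 - 1 / 6 :> R by field; lra.
  lra.
have T0 : (0 < #|{: {ffun J * K -> V} * V}|)%N.
  by rewrite card_prod muln_gt0 V0 card_ffun expn_gt0 V0.
pose Q (k : L) (t : {ffun J * K -> V} * V) :=
  match k with
  | inl s => pat_hom pat1 E (fun j => oapp t.1 t.2 (s j))
  | inr s => pat_hom pat2 E (fun j => oapp t.1 t.2 (s j))
  end.
have [k dk] : exists k, dense (c2 / #|{: L}|%:R) (Q k).
  apply: dense_cover c20 _ T0 dV => t /orP[]/existsP[s Hs]; first by exists (inl s).
  by exists (inr s).
have {dk}dk : dense (c2 / (#|{: L}|%:R + 1)) (Q k).
  apply: dense_le dk; rewrite ler_pM2l // lef_pV2 ?posrE // ?lerDl ?ler01 //.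
  by rewrite ltr0n; apply/card_gt0P; exists k.
case: k dk => s dk; [left|right]; by apply: dense_extend dk => //; rewrite divr_gt0.
Qed.
End Weights.

(** * The tower of cones *)

Section Cones.
Variable R : archiRealFieldType.

(* Which of the two patterns is dense may depend on the hypergraph. *)
Definition either (J1 J2 : finType) (pat1 : pattern J1) (pat2 : pattern J2) :=
  exists (d c : R) (n0 : nat), [/\ 0 < d, 0 < c &
  forall (V : finType) (E : V -> V -> V -> bool), indep_nbhs E -> (n0 <= #|V|)%N ->
    codegree_ge (1 / 3 - d) E ->
    dense c (fun f : {ffun J1 -> V} => pat_hom pat1 E f) \/
    dense c (fun f : {ffun J2 -> V} => pat_hom pat2 E f)].

(** A degenerate dichotomy, so that [either_step] chains both kinds of statement. *)
Definition common (J : finType) (pat : pattern J) := either pat pat.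

Lemma codegree_ge_le (d d' : R) (V : finType) (E : V -> V -> V -> bool) :
  d' <= d -> codegree_ge d E -> codegree_ge d' E.
Proof. by move=> dd H x y xy; apply: le_trans (H x y xy); rewrite ler_wpM2r. Qed.

Lemma cone_pat_neq (Q : finType) (a b c : option Q) :
  cone_pat a b c -> [/\ a != b, b != c & a != c].
Proof. by case/andP => /complete_pat_neq. Qed.

Lemma dense_neq (V : finType) : (1 < #|V|)%N ->
  dense (1 / 2 : R) (fun t : V * V => t.1 != t.2).
Proof.
move=> V1; rewrite /dense card_prod natrM (card_pair_dep (fun x y => x != y)).
rewrite (eq_bigr (fun=> #|V|.-1)) => [|x _].
  rewrite sum_nat_const natrM -[X in _ <= X * _]/(#|V|%:R : R) mulrCA ler_wpM2l ?ler0n //.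
  have : (#|V| <= 2 * #|V|.-1)%N by lia.
  by rewrite -(ler_nat R) natrM; lra.
by rewrite -(cardC1 x); apply: eq_card => y; rewrite !inE eq_sym.
Qed.

(** A cone over two base vertices is a single edge, and [1 / 3 - 1 / 12 = 1 / 4] bounds the
    codegrees. *)
Lemma common_edge : common (@cone_pat bool).
Proof.
exists (1 / 12), (1 / 2 * (1 / 4)), 2%N; split=> [||V E HE V2 dE]; [lra | lra | left].
have d1 := dense_pair (U := V) (P := fun t z => E t.1 t.2 z) (b := 1 / 4 : R) _ (dense_neq V2).
pose g (f : {ffun option bool -> V}) := ((f None, f (Some true)), f (Some false)).
have g_bij : bijective g.
  pose h (t : V * V * V) : {ffun option bool -> V} :=
    [ffun o => match o with None => t.1.1 | Some true => t.1.2 | Some false => t.2 end].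
  exists h => [f|[[x y] z]]; last by rewrite /g /h !ffunE.
  by apply/ffunP => -[[]|]; rewrite ffunE.
have /(dense_bij _ _ g_bij) : dense (1 / 2 * (1 / 4) : R) (fun t : V * V * V => E t.1.1 t.1.2 t.2).
  apply: dense_sub (d1 _ _) => [t /andP[_]//| |[x y] xy]; first by lra.
  by apply: le_trans (dE _ _ xy); rewrite ler_wpM2r //; lra.
apply: dense_sub => f Ef; apply: (cone_homP HE) => -[] [] //= _.
by rewrite (adjC23 HE).
Qed.

Lemma either_step (J1 J2 J3 J4 : finType) (p1 : pattern J1) (p2 : pattern J2)
    (p3 : pattern J3) (p4 : pattern J4) :
  either p1 p2 ->
  (forall c : R, 0 < c -> exists (d c' : R) (n0 : nat), [/\ 0 < d, 0 < c' &
    forall (V : finType) (E : V -> V -> V -> bool), indep_nbhs E -> (n0 <= #|V|)%N ->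
      codegree_ge (1 / 3 - d) E -> dense c (fun f : {ffun J1 -> V} => pat_hom p1 E f) ->
      dense c' (fun f : {ffun J3 -> V} => pat_hom p3 E f) \/
      dense c' (fun f : {ffun J4 -> V} => pat_hom p4 E f)]) ->
  (forall c : R, 0 < c -> exists (d c' : R) (n0 : nat), [/\ 0 < d, 0 < c' &
    forall (V : finType) (E : V -> V -> V -> bool), indep_nbhs E -> (n0 <= #|V|)%N ->
      codegree_ge (1 / 3 - d) E -> dense c (fun f : {ffun J2 -> V} => pat_hom p2 E f) ->
      dense c' (fun f : {ffun J3 -> V} => pat_hom p3 E f) \/
      dense c' (fun f : {ffun J4 -> V} => pat_hom p4 E f)]) ->
  either p3 p4.
Proof.
move=> [d [c [n0 [d0 c0 H]]]] /(_ c c0)[d1 [c1 [n1 [d10 c10 H1]]]].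
move=> /(_ c c0)[d2 [c2 [n2 [d20 c20 H2]]]].
exists (Num.min d (Num.min d1 d2)), (Num.min c1 c2), (maxn n0 (maxn n1 n2)).
split; rewrite ?lt_min ?d0 ?d10 ?c10 // => V E HE.
rewrite !geq_max => /and3P[V0 V1 V2] dE.
have dle d' : Num.min d (Num.min d1 d2) <= d' -> codegree_ge (1 / 3 - d') E.
  by move=> h; apply: codegree_ge_le dE; rewrite lerD2l lerN2.
have le1 : Num.min c1 c2 <= c1 by rewrite ge_min lexx.
have le2 : Num.min c1 c2 <= c2 by rewrite ge_min lexx orbT.
have {}H := H V E HE V0 (dle _ _); have {}H1 := H1 V E HE V1 (dle _ _).
have {}H2 := H2 V E HE V2 (dle _ _); rewrite !ge_min !lexx !orbT in H H1 H2.
case: (H isT) => [/(H1 isT)|/(H2 isT)] []; move=> h; [left|right|left|right].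
- exact: dense_le le1 h.
- exact: dense_le le1 h.
- exact: dense_le le2 h.
- exact: dense_le le2 h.
Qed.

Lemma weight_step1 (J J1 K : finType) (pat : pattern J) (pat1 : pattern J1) (k0 : K)
    (ws : seq ((J * K) * (J * K) * nat)) (M : nat) :
  (forall a b c, pat a b c -> [/\ a != b, b != c & a != c]) -> covers_pairs pat1 ->
  (forall t, t \in ws -> t.1.1 != t.1.2) -> (3 * M < \sum_(t <- ws) t.2)%N ->
  (forall (V : finType) (E : V -> V -> V -> bool) (f : J * K -> V) (p : V),
     indep_nbhs E -> blown_hom pat E f ->
     (link_weight E ws f p <= M)%N \/ extend_hom pat1 E f p) ->
  common pat -> common pat1.
Proof.
move=> patN cov wsN MW H Hc.
have S := weight_step (R := R) k0 patN cov cov wsN MW _.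
by apply: either_step Hc (S _) (S _) => V E f p HE fE;
   case: (H V E f p HE fE) => ?; [apply: Or31 | apply: Or32 | apply: Or31 | apply: Or32].
Qed.

Lemma common_triple : common (@cone_pat (option bool)).
Proof.
apply: (weight_step1 (None : option bool) (@cone_pat_neq bool) _ triple_weights_neq
  triple_weights_total _ common_edge).
  by apply: cone_pat_cover; rewrite card_option card_bool.
by move=> V E f p HE fE; apply: triple_pointwise.
Qed.

Lemma card_K4 : #|K4| = 4.
Proof. by rewrite !card_option card_bool. Qed.

Lemma either_quad : either (@cone_pat K4) (@complete_pat K4).
Proof.
have K2 : (2 < #|K4|)%N by rewrite card_K4.
have K3 : (2 < #|{: option bool}|)%N by rewrite card_option card_bool.
have S := weight_step (R := R) false (@cone_pat_neq (option bool))
  (@cone_pat_cover K4 (ltnW K2)) (@complete_pat_cover K4 K2) (@cone_weights_neq _)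
  (cone_weights_total K3) _.
apply: either_step common_triple (S _) (S _) => V E f p HE fE;
  case: (cone_pointwise p K3 HE fE) => [?|?|[_ ?]];
  by [apply: Or31 | apply: Or32 | apply: Or33].
Qed.

(** Of the two outcomes of [either_quad], the first is the goal itself; from dense complete 4-vertex
    subgraphs the goal comes by a separate weighting, with [p] as apex over the four copies of one
    vertex. *)
Lemma common_quad : common (@cone_pat K4).
Proof.
have K2 : (1 < #|K4|)%N by rewrite card_K4.
have S := weight_step (R := R) (None : K4) (@complete_pat_neq K4)
  (@cone_pat_cover K4 K2) (@cone_pat_cover K4 K2) quad_weights_neq quad_weights_total _.
apply: either_step either_quad _ (S _) => [c c0|V E f p HE fE].
  by exists 1, c, 0%N; split=> // V E _ _ _ ?; left.
by case: (quad_pointwise p HE fE) => ?; [apply: Or31 | apply: Or32].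
Qed.

Lemma common_cone_step (Q : finType) : (3 < #|Q|)%N ->
  common (@cone_pat Q) -> common (@cone_pat (option Q)).
Proof.
move=> Q3; have Q2 := ltnW Q3.
apply: (weight_step1 false (@cone_pat_neq Q) _ (@cone_weights_neq Q) (cone_weights_total Q2)).
  by apply: cone_pat_cover; rewrite card_option; lia.
move=> V E f p HE fE; case: (cone_pointwise p Q2 HE fE) => [?|?|[r3 _]]; [by left | by right |].
by rewrite r3 in Q3.
Qed.

Theorem common_cones (n : nat) : exists2 Q : finType, (n <= #|Q|)%N & common (@cone_pat Q).
Proof.
suff [Q /andP[Qn _] HQ] : exists2 Q : finType, (n <= #|Q|)%N && (3 < #|Q|)%N & common (@cone_pat Q).
  by exists Q.
elim: n => [|n [Q /andP[Qn Q3] HQ]].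
  by exists K4; [rewrite card_K4 | exact: common_quad].
exists (option Q); last exact: common_cone_step.
by rewrite card_option; lia.
Qed.

End Cones.

(** * The approximate structure *)

Section Rotate.
Variable R : archiRealFieldType.

Lemma markov_card (T : finType) (A : {set T}) (m : T -> nat) (t b : R) :
  (forall p, p \in A -> t <= (m p)%:R) -> (\sum_(p in A) m p)%:R <= b -> #|A|%:R * t <= b.
Proof.
move=> H; apply: le_trans; rewrite natr_sum mulr_natl -sumr_const.
exact: ler_sum.
Qed.

Lemma natr_sqr_bound (n : nat) (a : R) : 0 <= a -> (n * n.-1)%:R <= a ^+ 2 -> n%:R <= a + 1.
Proof.
case: n => [|n] a0; first by rewrite addr_ge0.
rewrite /= natrM -natr1 => H; rewrite lerD2r leNgt; apply/negP => an.
by have : 0 <= n%:R :> R by []; nra.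
Qed.

Variables (V : finType) (E : V -> V -> V -> bool).
Hypothesis HE : indep_nbhs E.
Local Notation N := (#|V|%:R : R).
Local Notation G := (nbh E).

Lemma nbh_disjoint x y a b : E x y a -> E x y b -> [disjoint G x y & G a b].
Proof.
move=> xa xb; rewrite -setI_eq0; apply/eqP/setP => z; rewrite !inE.
by apply/negbTE/negP => /andP[xz abz]; have := adj_indep HE xa xb xz; rewrite abz.
Qed.

Lemma card_setI_disjoint (A B Y : {set V}) (b : R) :
  [disjoint A & B] -> #|Y :\: B|%:R <= b -> #|A :&: Y|%:R <= b.
Proof.
move=> AB; apply: le_trans; rewrite ler_nat; apply: subset_leq_card.
apply/subsetP => z; rewrite !inE => /andP[zA zY]; rewrite zY andbT.
by apply: contraL zA => zB; rewrite (disjointFl AB zB).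
Qed.

(* If all pairs of [X] have neighbourhood close to [Y], then the neighbourhoods of the
   pairs of [Y'] avoid [Y], because some pair of [X] is a common neighbour, and
   avoid [X], because most pairs [y], [p] with [p] in [X] have most of [X] as
   neighbours. *)
Lemma rotate (X Y : {set V}) (s t : R) : 0 < s -> s <= 1 / 16 -> 32 <= N -> N / 4 <= #|X|%:R ->
  (forall u v, u \in X -> v \in X -> u != v -> #|Y :\: G u v|%:R <= t * N) ->
  exists Y' : {set V}, [/\ Y' \subset Y, #|Y :\: Y'|%:R * s ^+ 2 <= t * N &
    forall y y', y \in Y' -> y' \in Y' -> y != y' ->
      #|G y y' :&: Y|%:R <= t * N /\ #|G y y' :&: X|%:R <= 8 * s ^+ 2 * N].
Proof.
move=> s0 s1 N32 X4 HX.
pose pairs := off_diag X; have card_pairs := card_off_diag X.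
pose miss y := [set q in pairs | ~~ E y q.1 q.2].
(* The set kept consists of the vertices of [Y] whose link misses few pairs of [X]; Markov's
   inequality bounds the others. *)
exists [set y in Y | #|miss y|%:R <= s ^+ 2 * N ^+ 2].
have N0 : 0 < N by lra.
split; first by apply/subsetP => y; rewrite inE => /andP[].
- set Z := Y :\: _.
  suff : #|Z|%:R * (s ^+ 2 * N ^+ 2) <= t * N * N ^+ 2.
    by rewrite mulrA ler_pM2r // exprn_gt0.
  apply: (markov_card (m := fun y => #|miss y|)).
    move=> y; rewrite !inE => /andP[]; case: (y \in Y) => //=.
    by rewrite -ltNge => /ltW.
  apply: le_trans (_ : (\sum_(y in Y) #|miss y|)%:R <= _).
    rewrite ler_nat [leqRHS](big_setID Z) /=.
    by rewrite (setIidPr (subsetDl _ _)) leq_addr.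
  rewrite sum_card_sym natr_sum.
  apply: le_trans (_ : \sum_(q in pairs) t * N <= _).
    apply: ler_sum => -[u v]; rewrite inE /= => /and3P[uX vX uv].
    apply: le_trans (HX u v uX vX uv); rewrite ler_nat; apply: subset_leq_card.
    by apply/subsetP => y; rewrite !inE -(adj_rot y u v HE) andbC.
  rewrite sumr_const -[leLHS]mulr_natr ler_wpM2l //.
    have [q qp] : exists q, q \in pairs.
      apply/set0Pn; rewrite -card_gt0 card_off_diag muln_gt0 -(ltr0n R) -[X in _ && X](ltr0n R).
      have X1 : (1 < #|X|)%N by rewrite -(ltr_nat R); lra.
      by rewrite !ltr0n; lia.
    move: qp; rewrite inE => /and3P[h1 h2 h3].
    by apply: le_trans (HX _ _ h1 h2 h3); rewrite ler0n.
  by rewrite -natrX ler_nat -[X in (_ <= X ^ 2)%N]/(#|V|) expnS expn1 -card_prod max_card.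
move=> y y'; rewrite !inE => /andP[yY my] /andP[yY' my'] yy'; split.
  (* [y] and [y'] together miss at most [N ^ 2 / 128] pairs, fewer than [X] has, so some pair [q] is
     joined to both. *)
  have [q qX] : exists q, q \in pairs :\: (miss y :|: miss y').
    apply/set0Pn; rewrite -card_gt0 cardsD subn_gt0 -(ltr_nat R).
    apply: le_lt_trans (_ : (#|miss y| + #|miss y'|)%:R < _).
      rewrite ler_nat; apply: leq_trans (subset_leq_card (subsetIr _ _)) _.
      by rewrite -cardsUI leq_addr.
    have E1 : #|pairs|%:R = #|X|%:R * (#|X|%:R - 1) :> R.
      rewrite card_pairs natrM -subn1 natrB // -(ltr0n R); lra.
    rewrite natrD E1; have s2 : s ^+ 2 <= 1 / 256 by nra.
    have N2 : 0 < N ^+ 2 by rewrite exprn_gt0.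
    have : s ^+ 2 * N ^+ 2 <= 1 / 256 * N ^+ 2 by rewrite ler_wpM2r // ltW.
    by nra.
  move: qX; rewrite !inE => /andP[+ /and3P[uX vX uv]].
  rewrite uX vX uv /= negb_or !negbK => /andP[].
  move=> yuv yuv'; apply: card_setI_disjoint (HX _ _ uX vX uv).
  by rewrite disjoint_sym; apply: nbh_disjoint; rewrite -(adj_rot _ _ _ HE).
suff : #|G y y' :&: X|%:R * (N / 8) <= s ^+ 2 * N ^+ 2.
  by rewrite !expr2 => H; rewrite -(ler_pM2r N0); lra.
apply: (markov_card (m := fun p => #|[pred u | (p, u) \in miss y]|)); last first.
  apply: le_trans my; rewrite ler_nat.
  have -> : #|miss y| = (\sum_p #|[pred u | (p, u) \in miss y]|)%N.
    by rewrite -(card_pair_dep (fun p u => (p, u) \in miss y)); apply: eq_card => -[p u].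
  by rewrite [leqRHS](bigID (mem (G y y' :&: X))) /= leq_addr.
move=> p; rewrite !inE => /andP[pyy' pX].
(* Since [y'] lies in [G y p], it misses every pair of [D], so [D] has at most [s * N + 1] vertices.
   Hence [p] is in at least [N / 4 - N / 16 - 2] missing pairs of [y], which is at least [N / 8] as
   [32 <= N]. *)
pose D := [set u in X | E y p u].
have D_le : #|D|%:R <= s * N + 1.
  apply: natr_sqr_bound; first by rewrite mulr_ge0 // ltW.
  rewrite -card_off_diag exprMn; apply: le_trans my'; rewrite ler_nat.
  apply: subset_leq_card; apply/subsetP => -[u v]; rewrite !inE /=.
  move=> /and3P[/andP[uX yu] /andP[vX yv] uv]; rewrite uX vX uv /=.
  apply/negP => y'uv; have := adj_indep HE (_ : E y p y') yu yv.
  by rewrite y'uv => H; have := H _; rewrite (adjC23 HE) => /(_ pyy').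
have X_le : (#|X| <= #|D| + #|[pred u | (p, u) \in miss y]| + 1)%N.
  rewrite (cardsD1 p X) pX addnC leq_add2r -cardUI.
  apply: leq_trans (leq_addr _ _); apply: subset_leq_card; apply/subsetP => u.
  rewrite !inE => /andP[up uX]; rewrite uX pX (eq_sym p) up /=.
  by case: (E y p u).
have : #|X|%:R <= #|D|%:R + #|[pred u | (p, u) \in miss y]|%:R + 1 :> R.
  by rewrite -natrD natr1 ler_nat -addn1.
have : s * N <= 1 / 16 * N by rewrite ler_wpM2r // ltW.
by lra.
Qed.
End Rotate.

Lemma index_budget (R : realFieldType) (r e a b c : R) : 0 < e -> 100 <= r * e ->
  100 <= r -> a * e <= e / 16 * r + 1 -> b * e <= e / 16 * r + 1 ->
  c * (r - 3) <= 1 / 100 * r ^+ 2 -> 1 + a + b + c < r.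
Proof.
move=> e0 re rb ha hb hc.
have ha' : a <= r / 16 + r / 100 by rewrite -(ler_pM2r e0); lra.
have hb' : b <= r / 16 + r / 100 by rewrite -(ler_pM2r e0); lra.
have r3 : 0 < r - 3 by lra.
have hc' : c <= r / 2.
  rewrite -(ler_pM2r r3); apply: le_trans hc _.
  have : 0 <= r * (r - 6) by rewrite mulr_ge0; lra.
  by rewrite expr2; lra.
lra.
Qed.

Lemma pairs_budget (R : realFieldType) (r a b s : R) : 100 <= r ->
  s <= 1 / 100 -> a <= s * r ^+ 2 -> b <= s * r ^+ 2 -> a + b < (r - 1) * (r - 2).
Proof.
move=> rb hs ha hb.
have h : s * r ^+ 2 <= 1 / 100 * r ^+ 2 by rewrite ler_wpM2r // exprn_ge0 //; lra.
have : 0 <= r * (r - 10) by rewrite mulr_ge0; lra.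
by move: h ha hb; rewrite expr2; lra.
Qed.

(** * Two apexes over one large base *)

Section Book.
Variable R : archiRealFieldType.
Variables (V : finType) (E : V -> V -> V -> bool) (d : R) (Q : finType).
Variables (w0 w1 : V) (x : Q -> V) (e : R).
Hypothesis HE : indep_nbhs E.
Hypothesis dE : codegree_ge (1 / 3 - d) E.
Hypothesis w01 : w0 != w1.
Hypothesis w0x : forall i j, i != j -> E w0 (x i) (x j).
Hypothesis w1x : forall i j, i != j -> E w1 (x i) (x j).
Hypotheses (e0 : 0 < e) (e1 : e <= 1 / 8).
Local Notation N := (#|V|%:R : R).
Local Notation r := (#|Q|%:R : R).
Local Notation G := (nbh E).
Hypotheses (rbig : 2000 <= r * e ^+ 3) (dsmall : d <= e ^+ 3 / 2000).

Let C := G w0 w1.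

Let GC y z : G y z = G z y.
Proof. by apply/setP => t; rewrite !inE (adjC12 HE). Qed.

Let G_ge y z : y != z -> (1 / 3 - d) * N <= #|G y z|%:R.
Proof.
move=> yz; apply: le_trans (dE yz) _; rewrite ler_nat; apply: subset_leq_card.
by apply/subsetP => t; rewrite !inE.
Qed.

Let neq_of y z t : E y z t -> y != z.
Proof. by apply: contraTneq => ->; rewrite (adj_irr HE). Qed.

Let x_neq i j : i != j -> x i != x j.
Proof. by move=> /w0x; rewrite (adj_rot _ _ _ HE) => /neq_of. Qed.

Let e3 : e ^+ 3 <= 1 / 512.
Proof.
have : e ^+ 3 <= (1 / 8) ^+ 3.
  by apply: lerXn2r => //; rewrite nnegrE; [apply: ltW | apply: divr_ge0].
by move/le_trans; apply; lra.
Qed.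

Let e3e : e ^+ 3 <= e.
Proof.
rewrite exprS -[leRHS]mulr1 ler_wpM2l ?exprn_ile1 // ltW //.
by apply: le_lt_trans e1 _; lra.
Qed.

Let r_big : 100 <= r.
Proof.
have r0 : 0 <= r by rewrite ler0n.
have : r * e ^+ 3 <= r * (1 / 512) by rewrite ler_wpM2l.
by have := rbig; lra.
Qed.

Let N0 : 0 < N.
Proof. by rewrite ltr0n; apply/card_gt0P; exists w0. Qed.

(** The sets [G w0 (x k) :&: C] are pairwise disjoint: a vertex [v] in two of them would put the
    edge [w1], [x k], [x j] inside [G w0 v]. The smallest of the [r] sets has at most [N / r]
    vertices. *)
Let exists_k : exists k, #|G w0 (x k) :&: C|%:R <= N / r.
Proof.
apply/existsP; rewrite -[X in is_true X]negbK; apply/negP => /existsPn H.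
have r0 : 0 < r by have := r_big; lra.
have : \sum_(k : Q) N / r < \sum_k #|G w0 (x k) :&: C|%:R.
  have [k _] : exists k : Q, true by move: r0; rewrite ltr0n => /card_gt0P[k _]; exists k.
  apply: ltr_sum => [|i _]; last by rewrite ltNge; apply: H.
  by apply/hasP; exists k; rewrite ?mem_index_enum.
rewrite sumr_const -[N / r *+ _](mulr_natr _ #|Q|) divfK ?gt_eqF // -natr_sum ltr_nat.
rewrite ltnNge => /negP; apply; rewrite card_sum_type.
under eq_bigr => k _ do rewrite card_sum_in.
rewrite exchange_big /=; apply: leq_sum => v _.
have [vC|vC] := boolP (v \in C); last by rewrite big1 // => k _; rewrite inE (negPf vC) andbF.
rewrite leqNgt; apply/negP => two.
have [k vk] : exists k, v \in G w0 (x k) :&: C.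
  apply/existsP; rewrite -[X in is_true X]negbK; apply/negP => /existsPn nv.
  by rewrite big1 // in two => k _; rewrite (negPf (nv k)).
move: two; rewrite (bigD1 k) //= vk add1n ltnS lt0n sum_nat_eq0 => /forallPn[j].
rewrite negb_imply eqb0 negbK => /andP[jk vj]; move: vk vj vC; rewrite !inE.
move=> /andP[vk _] /andP[vj _] vC.
have := adj_indep HE (_ : E w0 v w1) (_ : E w0 v (x k)) (_ : E w0 v (x j)).
rewrite !(adjC23 HE w0 v) => /(_ vC vk vj).
by rewrite w1x // eq_sym.
Qed.

Section Centre.
Variable k : Q.
Hypothesis kC : #|G w0 (x k) :&: C|%:R <= N / r.

Let B := ~: (G w0 (x k) :|: C).
(** The bound [1 / 3 + 2 * d + 1 / r] for [B] less the codegree bound [1 / 3 - d] for a subset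
    [G (x i) (x j)]. *)
Let t := 3 * d + 1 / r.

Let r0 : 0 < r. Proof. by have := r_big; lra. Qed.

Let t_le : t <= e * (e / 16) ^+ 2.
Proof.
have r1 : 2000 / r <= e ^+ 3 by rewrite ler_pdivrMr // mulrC.
rewrite /t (_ : e * (e / 16) ^+ 2 = e ^+ 3 / 256); last by field.
have -> : 1 / r = (2000 / r) / 2000 by field; rewrite gt_eqF.
have := dsmall; have : 0 <= e ^+ 3 by rewrite exprn_ge0 // ltW.
by lra.
Qed.

Let others (S : {set Q}) : (#|S| <= 3)%N -> exists i, i \notin S.
Proof.
move=> S3; apply/existsP; rewrite -[X in is_true X]negbK; apply/negP => /existsPn H.
have : (#|Q| <= #|S|)%N.
  by rewrite -cardsT; apply: subset_leq_card; apply/subsetP => i _; rewrite -[_ \in _]negbK.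
move=> /leq_trans/(_ S3); rewrite -(ler_nat R); have := r_big; lra.
Qed.

Let two_others : exists i j, [/\ i != k, j != k & i != j].
Proof.
have [|i] := others (S := [set k]); first by rewrite cards1.
rewrite inE => ik; have [|j] := others (S := [set k; i]); first by rewrite cards2; case: eqP.
rewrite !inE negb_or eq_sym => /andP[kj ij]; exists i, j.
by rewrite eq_sym; split; rewrite // eq_sym.
Qed.

Let w0_xk : w0 != x k.
Proof.
by have [i [_ [ik _ _]]] := two_others; apply: neq_of (w0x (_ : k != i)); rewrite eq_sym.
Qed.

(** [x i] and [x j] lie in [G w0 (x k)], and [w0] and [w1] lie in [G (x i) (x j)]; both times
    [nbh_disjoint] applies. *)
Let GB i j : i != k -> j != k -> i != j -> G (x i) (x j) \subset B.
Proof.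
move=> ik jk ij; apply/subsetP => z zG; rewrite inE in_setU negb_or; apply/andP; split.
  have := nbh_disjoint HE (x := w0) (y := x k) (a := x i) (b := x j) _ _.
  rewrite !w0x 1?eq_sym // => /(_ isT isT); rewrite disjoint_sym => H.
  by rewrite (disjointFr H zG).
have := nbh_disjoint HE (x := x i) (y := x j) (a := w0) (b := w1) _ _.
by rewrite -!(adj_rot _ (x i) (x j) HE) w0x // w1x // => /(_ isT isT) H; rewrite (disjointFr H zG).
Qed.

Let B_le : #|B|%:R <= (1 / 3 + 2 * d + 1 / r) * N.
Proof.
have h1 := G_ge w0_xk; have h2 := G_ge w01.
have : #|B|%:R + #|G w0 (x k)|%:R + #|C|%:R = N + #|G w0 (x k) :&: C|%:R.
  rewrite -!natrD; congr (_%:R).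
  rewrite card_sum_type !card_sum_in -!big_split /=; apply: eq_bigr => v _.
  by rewrite !inE; case: (E w0 (x k) v); case: (E w0 w1 v).
by have := kC; rewrite -/C in h2; lra.
Qed.

Let B_gap i j : i != k -> j != k -> i != j -> #|B :\: G (x i) (x j)|%:R <= t * N.
Proof.
move=> ik jk ij; have h1 := G_ge (x_neq ij); have := cardsID (G (x i) (x j)) B.
rewrite (setIidPr (GB ik jk ij)) => /(congr1 (fun n => n%:R : R)); rewrite natrD.
by have := B_le; rewrite /t; lra.
Qed.

Let s := e / 16.
Let bad p := [set q : Q * Q | [&& q.1 != k, q.2 != k, q.1 != q.2 & ~~ E p (x q.1) (x q.2)]].
(** The vertices of [B] joined to nearly all pairs of the base, hence behaving almost like the
    apexes themselves. *)
Let U := [set p in B | #|bad p|%:R <= s ^+ 2 * r ^+ 2].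

Let s0 : 0 < s. Proof. exact: divr_gt0. Qed.

Let U_large : #|B :\: U|%:R <= e * N.
Proof.
have r2 : 0 < r ^+ 2 by rewrite exprn_gt0.
have : #|B :\: U|%:R * (s ^+ 2 * r ^+ 2) <= t * N * r ^+ 2.
  apply: (markov_card (m := fun p => #|bad p|)) => [p|].
    by rewrite in_setD => /andP[+ pB]; rewrite inE pB /= -ltNge => /ltW.
  apply: le_trans (_ : (\sum_(p in B) #|bad p|)%:R <= _).
    rewrite ler_nat [leqRHS](big_setID (B :\: U)) /=.
    by rewrite (setIidPr (subsetDl _ _)) leq_addr.
  (* Writing the full set as a union with a complement only puts the sum in the shape that
     [sum_card_sym] exchanges. *)
  have -> : (\sum_(p in B) #|bad p| = \sum_(p in B) #|[set q in bad w0 :|: ~: bad w0 |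
      [&& q.1 != k, q.2 != k, q.1 != q.2 & ~~ E p (x q.1) (x q.2)]]|)%N.
    by apply: eq_bigr => p _; congr #|pred_of_set _|; apply/setP => q; rewrite !inE orbN.
  rewrite setUCr sum_card_sym natr_sum.
  apply: le_trans (_ : \sum_(q in [set: Q * Q]) t * N <= _).
    apply: ler_sum => -[i j] _ /=.
    have [/and3P[ik jk ij]|nq] := boolP [&& i != k, j != k & i != j].
      apply: le_trans (B_gap ik jk ij); rewrite ler_nat; apply: subset_leq_card.
      apply/subsetP => p; rewrite in_setD inE => /andP[pB /and4P[_ _ _ nE]].
      by rewrite pB andbT inE -(adj_rot p _ _ HE).
    rewrite (_ : [set p in B | _] = set0) ?cards0; last first.
      apply/setP => p; rewrite !inE; apply: contraNF nq.
      by case/andP => _ /and4P[-> -> ->].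
    have [i' [j' [ik jk ij]]] := two_others.
    by apply: le_trans (B_gap ik jk ij).
  rewrite sumr_const -[leLHS]mulr_natr cardsT card_prod natrM expr2 //.
move=> H; have tN : t * N * r ^+ 2 <= e * s ^+ 2 * N * r ^+ 2.
  by rewrite ler_pM2r // ler_pM2r.
have sr : 0 < s ^+ 2 * r ^+ 2 by rewrite mulr_gt0 // exprn_gt0.
rewrite -(ler_pM2r sr); apply: le_trans H (le_trans tN _).
by rewrite le_eqVlt; apply/orP; left; apply/eqP; ring.
Qed.

(** Puts both [w0] and [w1] in [U], where [near] can compare other vertices with them. *)
Let inU w : (forall i j, i != j -> E w (x i) (x j)) -> w \in U.
Proof.
move=> wx; have [i [j [ik jk ij]]] := two_others; rewrite inE.
have wG : w \in G (x i) (x j) by rewrite inE -(adj_rot w _ _ HE) wx.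
rewrite (subsetP (GB ik jk ij) _ wG) (_ : bad w = set0) ?cards0.
  by rewrite mulr_ge0 // exprn_ge0 // ltW.
by apply/setP => -[i' j']; rewrite !inE /=; apply/negP => /and4P[_ _ h]; rewrite wx.
Qed.

Let re : 100 <= r * e.
Proof.
have : r * e ^+ 3 <= r * e by rewrite ler_wpM2l ?e3e // ltW.
by have := rbig; lra.
Qed.

Let s_le : s ^+ 2 <= 1 / 100.
Proof. by rewrite /s; have := e0; have := e1; nra. Qed.

Let pencil u q := [set i | (i != k) && E u (x i) q].

(** For [i], [j] in the pencil, [v], [x i] and [x j] all lie in [G u q], so [(i, j)] is bad for [v],
    which has few bad pairs. *)
Let pencil_le u v q : v \in U -> q \in G u v -> #|pencil u q|%:R <= s * r + 1.
Proof.
rewrite [v \in U]inE [q \in _]inE => /andP[_ bv] uvq.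
apply: natr_sqr_bound; first by rewrite mulr_ge0 // ltW.
rewrite -card_off_diag exprMn; apply: le_trans bv; rewrite ler_nat.
apply: subset_leq_card; apply/subsetP => -[i j]; rewrite !inE /=.
case/and3P => /andP[-> ui] /andP[-> uj] ->; rewrite /=.
have := adj_indep HE (_ : E u q v) (_ : E u q (x i)) (_ : E u q (x j)).
by rewrite !(adjC23 HE u q) => /(_ uvq ui uj) ->.
Qed.

Let crowded u v := [set i | (i != k) && (e * N < #|G u (x i) :&: G u v|%:R)].

(** Counts the pairs of an index [i] and a vertex [q] common to [G u (x i)] and [G u v]: at least
    [e * N] per crowded index, at most a pencil per [q]. *)
Let crowded_le u v : v \in U -> #|crowded u v|%:R * e <= s * r + 1.
Proof.
move=> vU; rewrite -(ler_pM2r N0) -mulrA.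
apply: (markov_card (m := fun i => #|G u (x i) :&: G u v|)) => [i|].
  by rewrite inE => /andP[_ /ltW].
apply: le_trans (_ : (\sum_(q in G u v) #|pencil u q|)%:R <= _).
  rewrite ler_nat; apply: leq_trans (_ : \sum_(i in [set~ k]) #|G u (x i) :&: G u v| <= _)%N.
    rewrite [leqRHS](big_setID (crowded u v)) /= (setIidPr _) ?leq_addr //.
    by apply/subsetP => i; rewrite !inE => /andP[].
  have Ei i : #|G u (x i) :&: G u v| = #|[set q in G u v | E u (x i) q]|.
    by congr #|pred_of_set _|; apply/setP => q; rewrite !inE andbC.
  rewrite (eq_bigr _ (fun i _ => Ei i)).
  rewrite sum_card_sym; apply: leq_sum => q _; apply: subset_leq_card.
  by apply/subsetP => i; rewrite !inE.
rewrite natr_sum; apply: le_trans (_ : \sum_(q in G u v) (s * r + 1) <= _).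
  by apply: ler_sum => q; apply: pencil_le.
rewrite sumr_const -[leLHS]mulr_natr ler_wpM2l ?ler_nat ?max_card //.
by rewrite addr_ge0 // mulr_ge0 // ltW.
Qed.

Let sparse u := [set i | (i != k) && (#|[set j | (j != k) && E u (x i) (x j)]| <= 1)%N].

(** A sparse [i] is in a bad pair with all indices but [k], itself and at most one more, whence
    [r - 3]. *)
Let sparse_le u : u \in U -> #|sparse u|%:R * (r - 3) <= s ^+ 2 * r ^+ 2.
Proof.
rewrite inE => /andP[_ bu].
apply: (markov_card (m := fun i => #|[set j | (i, j) \in bad u]|)) => [i|].
  rewrite inE => /andP[ik si].
  have : (#|Q| <= #|[set j | (j != k) && E u (x i) (x j)]| +
            #|[set j | (i, j) \in bad u]| + 2)%N.
    apply: (@leq_trans (#|[set j | (j != k) && E u (x i) (x j)]| +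
            #|[set j | (i, j) \in bad u]| + #|[set k; i]|)%N); last first.
      by rewrite leq_add2l cards2; case: eqP.
    rewrite card_sum_type !card_sum_in -!big_split /=; apply: leq_sum => j _.
    rewrite !inE /= ik; case: (j == k); case: (E _ _ _) => //=; rewrite ?addn0 ?orbT //.
    by rewrite eq_sym; case: (j == i).
  move=> /leq_trans/(_ (leq_add (leq_add si (leqnn _)) (leqnn _))).
  by rewrite -(ler_nat R) !natrD; lra.
apply: le_trans bu; rewrite ler_nat.
have -> : #|bad u| = (\sum_i #|[set j | (i, j) \in bad u]|)%N.
  under eq_bigr => i _ do rewrite cardsE.
  by rewrite -(card_pair_dep (fun i j => (i, j) \in bad u)); apply: eq_card => -[i j].
by rewrite [leqRHS](bigID (mem (sparse u))) /= leq_addr.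
Qed.

(** Crowded indices take up under [r / 6] twice and sparse ones at most [r / 2], so an index is left
    over. It lets [G u (x i)] be the third class against which [G u v] and [G u v'] are compared;
    two neighbours [x j], [x l] make it almost avoid [B]. *)
Let good_index u v v' : u \in U -> v \in U -> v' \in U -> exists i,
  [/\ i != k, #|G u (x i) :&: G u v|%:R <= e * N, #|G u (x i) :&: G u v'|%:R <= e * N &
     (1 < #|[set j | (j != k) && E u (x i) (x j)]|)%N].
Proof.
move=> uU vU v'U.
have [i] : exists i, i \notin ([set k] :|: crowded u v) :|: (crowded u v' :|: sparse u).
  apply/existsP; rewrite -[X in is_true X]negbK; apply/negP => /existsPn H.
  have : (#|Q| <= 1 + #|crowded u v| + #|crowded u v'| + #|sparse u|)%N.
    rewrite -cardsT -(cards1 k) -addnA.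
    apply: leq_trans (leq_add (leq_card_setU _ _) (leq_card_setU _ _)).
    apply: leq_trans (leq_card_setU _ _); apply: subset_leq_card.
    by apply/subsetP => i _; have := H i; rewrite negbK.
  rewrite -(ler_nat R) !natrD leNgt => /negP; apply.
  apply: (index_budget e0 re r_big (crowded_le u vU) (crowded_le u v'U)).
  by apply: le_trans (sparse_le uU) _; rewrite ler_wpM2r ?s_le // exprn_ge0 // ltW.
rewrite !inE !negb_or => /andP[/andP[ik c1] /andP[c2 sp]]; exists i.
by move: c1 c2 sp; rewrite !ik /= -!leNgt -ltnNge.
Qed.

(* [u] and [v] both lie in [G (x i) (x j)] for some [i], [j], which is almost [B]. *)
Let pair_in_B u v : u \in U -> v \in U -> #|G u v :&: B|%:R <= t * N.
Proof.
move=> uU vU; pose P := off_diag [set~ k].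
have [q qP] : exists q, q \in P :\: (bad u :|: bad v).
  apply/set0Pn; rewrite -card_gt0 cardsD subn_gt0 -(ltr_nat R).
  apply: le_lt_trans (_ : (#|bad u| + #|bad v|)%:R < _).
    rewrite ler_nat; apply: leq_trans (subset_leq_card (subsetIr _ _)) _.
    exact: leq_card_setU.
  move: uU vU; rewrite !inE => /andP[_ bu] /andP[_ bv].
  have c1 : #|[set~ k]|%:R = r - 1 :> R by rewrite cardsC1 -subn1 natrB // -(ltr0n R).
  have -> : #|P|%:R = (r - 1) * (r - 2) :> R.
    rewrite card_off_diag natrM c1; congr (_ * _).
    rewrite -subn1 natrB ?c1; first by lra.
    by rewrite -(ltr0n R) c1; have := r_big; lra.
  by rewrite natrD; apply: (pairs_budget r_big s_le).
move: qP; rewrite !inE => /andP[+ /and3P[h1 h2 h3]].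
rewrite h1 h2 h3 /= negb_or !negbK => /andP[uq vq].
apply: card_setI_disjoint (B_gap h1 h2 h3).
by rewrite disjoint_sym; apply: nbh_disjoint; rewrite // -(adj_rot _ _ _ HE).
Qed.

(* [B], [G u (x i)] and [G u v] almost partition the vertices, and so do [B],
   [G u (x i)] and [G u v']. *)
Let near u v v' : u \in U -> v \in U -> v' \in U -> u != v -> u != v' ->
  #|G u v :\: G u v'|%:R <= 6 * e * N.
Proof.
move=> uU vU v'U uv uv'; have [i [ik h1 h2 h3]] := good_index uU vU v'U.
have [j [l [jA lA jl]]] := card_gt1P h3.
move: jA lA; rewrite !inE => /andP[jk uj] /andP[lk ul].
have AB : #|G u (x i) :&: B|%:R <= t * N.
  by apply: card_setI_disjoint (B_gap jk lk jl); apply: nbh_disjoint.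
(* Three codegree deficits [d], three overlaps with [B] of size [t] and two overlaps [e] with
   [G u (x i)]: since [3 * d <= e] and [t <= e], the sum is at most [6 * e]. *)
have := card_near (G u (x i)) B (G u v) (G u v').
rewrite -(ler_nat R) !natrD [G u v :&: G u (x i)]setIC [G u v' :&: G u (x i)]setIC.
have := pair_in_B uU vU; have := pair_in_B uU v'U.
have := G_ge uv'; have := G_ge (_ : u != x i); rewrite (neq_of uj) => /(_ isT).
have : (1 / 3 - d) * N <= #|B|%:R.
  apply: le_trans (G_ge (x_neq jl)) _; rewrite ler_nat; apply: subset_leq_card.
  exact: GB.
have tN : t * N <= e * N.
  rewrite ler_pM2r //; apply: le_trans t_le _.
  by rewrite -[leRHS]mulr1 ler_wpM2l ?(ltW e0) //; have := s_le; rewrite /s; lra.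
have dN : d * N <= e / 3 * N.
  rewrite ler_pM2r //; apply: le_trans dsmall _.
  by have := e0; have := e3e; lra.
by lra.
Qed.

Lemma book_structure_at : exists U' : {set V}, [/\ [disjoint U' & C],
  (1 / 3 - 2 * e) * N <= #|U'|%:R,
  (1 / 3 - 2 * e) * N <= #|C|%:R &
  forall u v, u \in U' -> v \in U' -> u != v ->
    #|G u v :\: C|%:R <= 12 * e * N /\ #|C :\: G u v|%:R <= 12 * e * N].
Proof.
have dN : d * N <= e * N.
  rewrite ler_pM2r //; apply: le_trans dsmall _.
  by have := e0; have := e3e; lra.
exists U; split.
- rewrite -setI_eq0; apply/eqP/setP => z; rewrite !inE.
  by apply/negbTE; rewrite negb_and; case: (E w0 w1 z) => //=; rewrite orbT.
- have [i [j [ik jk ij]]] := two_others.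
  have h1 := G_ge (x_neq ij); have h2 := U_large.
  have h3 : #|G (x i) (x j)|%:R <= #|B|%:R :> R.
    by rewrite ler_nat; apply: subset_leq_card; apply: GB.
  have h4 : #|B|%:R <= #|U|%:R + #|B :\: U|%:R :> R.
    rewrite -natrD ler_nat -(cardsID U B) leq_add2r.
    by apply: subset_leq_card; apply: subsetIr.
  by lra.
- have eN0 : 0 <= e * N by rewrite mulr_ge0 // ltW.
  by have := G_ge w01; rewrite -/C; lra.
have w0U := inU w0x; have w1U := inU w1x.
have tri (X Y Z : {set V}) (a b : R) : #|X :\: Y|%:R <= a -> #|Y :\: Z|%:R <= b ->
    #|X :\: Z|%:R <= a + b.
  move=> h1 h2; apply: le_trans (lerD h1 h2); rewrite -natrD ler_nat.
  rewrite !card_sum_in -big_split /=; apply: leq_sum => z _.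
  by rewrite !inE; case: (z \in X); case: (z \in Y); case: (z \in Z).
have eN : 0 <= 6 * e * N by rewrite !mulr_ge0 // ltW.
have -> : 12 * e * N = 6 * e * N + 6 * e * N by ring.
have w10 : w1 != w0 by rewrite eq_sym.
move=> u v uU vU uv; have [uw|uw] := eqVneq u w0.
  have h1 := near w0U vU w1U; have h2 := near w0U w1U vU.
  move: uv; rewrite uw => uv; split; apply: (le_trans (y := 6 * e * N));
    rewrite ?lerDl //; [exact: h1 | exact: h2].
(* Two moves, each costing [6 * e]: from [G u v] to [G u w0] around [u], then from [G w0 u] to
   [G w0 w1] around [w0]. The case [u = w0] needed only the second. *)
split.
  apply: (tri _ (G u w0)); first by apply: near => //; rewrite eq_sym.
  by rewrite GC; apply: near => //; rewrite eq_sym.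
apply: (tri _ (G u w0)); last by apply: near => //; rewrite eq_sym.
by rewrite [G u w0]GC; apply: near => //; rewrite eq_sym.
Qed.

End Centre.

Lemma book_structure : exists U : {set V}, [/\ [disjoint U & C],
  (1 / 3 - 2 * e) * N <= #|U|%:R,
  (1 / 3 - 2 * e) * N <= #|C|%:R &
  forall u v, u \in U -> v \in U -> u != v ->
    #|G u v :\: C|%:R <= 12 * e * N /\ #|C :\: G u v|%:R <= 12 * e * N].
Proof. by have [k kC] := exists_k; apply: (book_structure_at kC). Qed.
End Book.

(** * From a book to three classes *)

Section Structure.
Variable R : archiRealFieldType.

(** Doubling a large cone gives two copies of the apex over the same base, and an injective copy
    keeps them distinct. *)
Lemma exists_book (n : nat) : exists (d : R) (n0 : nat), 0 < d /\
  forall (V : finType) (E : V -> V -> V -> bool), indep_nbhs E -> (n0 <= #|V|)%N ->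
    codegree_ge (1 / 3 - d) E ->
  exists (Q : finType) (w0 w1 : V) (x : Q -> V), [/\ (n <= #|Q|)%N, w0 != w1,
    forall i j, i != j -> E w0 (x i) (x j) & forall i j, i != j -> E w1 (x i) (x j)].
Proof.
have [Q nQ [d [c [n0 [d0 c0 H]]]]] := common_cones R n.
have [c1 c10 H1] := dense_blowup (R := R) (option Q) false c0.
have [n1 H2] := dense_injective (R := R) (option Q * bool)%type c10.
exists d, (maxn 1 (maxn n0 n1)); split=> // V E HE; rewrite !geq_max => /and3P[V0 V1 V2] dE.
have dP : dense c (fun f : {ffun option Q -> V} => pat_hom (@cone_pat Q) E f).
  by case: (H V E HE V1 dE).
have {}dP := H2 _ _ V2 V0 (H1 _ _ V0 dP).
have: (0 < #|[pred F : {ffun option Q * bool -> V} |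
     [forall s, pat_hom (@cone_pat Q) E (select F s)] && injectiveb F]|)%N.
  rewrite -(ltr0n R); apply: lt_le_trans dP.
  by rewrite mulr_gt0 ?divr_gt0 // ltr0n card_ffun expn_gt0 V0.
case/card_gt0P => F; rewrite inE => /andP[/forallP FP /injectiveP F_inj].
exists Q, (F (None, false)), (F (None, true)), (fun i => F (Some i, false)).
have key b i j : i != j -> E (F (None, b)) (F (Some i, false)) (F (Some j, false)).
    move=> ij; have /pat_homP := FP [ffun o => if o is None then b else false].
    move=> /(_ None (Some i) (Some j)); rewrite !ffunE; apply.
    by rewrite /cone_pat /complete_pat /= !inE /= ?andbT; apply: ij.
by split=> //; [rewrite (inj_eq F_inj) | apply: key | apply: key].
Qed.

(** A single arrow from [A] to [B]; the cyclic structure consists of three of them. *)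
Definition cyclic_triple (V : finType) (E : V -> V -> V -> bool) (h : R) (A B : {set V}) :=
  forall u v, u \in A -> v \in A -> u != v ->
    #|nbh E u v :\: B|%:R <= h * #|V|%:R /\ #|B :\: nbh E u v|%:R <= h * #|V|%:R.

(** The scales satisfy [e], [s], [q] in increasing order because a rotation with input error [t]
    loses [t / s ^ 2] of the class and outputs an error of order [s ^ 2]. The cubic conditions keep
    the losses below [s] and then [q]. *)
Lemma cyclic_triple_of_book (V : finType) (E : V -> V -> V -> bool) (d e s q : R) (U C : {set V}) :
  indep_nbhs E -> codegree_ge (1 / 3 - d) E -> 32 <= #|V|%:R :> R ->
  0 < e -> e <= q -> 0 <= d -> d <= q -> 0 < s -> s <= q -> 0 < q -> q <= 1 / 100 ->
  12 * e <= s ^+ 3 -> 8 * s ^+ 2 + 16 * e + d <= q ^+ 3 ->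
  [disjoint U & C] -> (1 / 3 - 2 * e) * #|V|%:R <= #|U|%:R ->
  (1 / 3 - 2 * e) * #|V|%:R <= #|C|%:R -> cyclic_triple E (12 * e) U C ->
  exists A' C' : {set V}, [/\ [/\ [disjoint A' & U], [disjoint U & C'] & [disjoint C' & A']],
    [/\ (1 / 3 - 5 * q) * #|V|%:R <= #|A'|%:R, (1 / 3 - 5 * q) * #|V|%:R <= #|U|%:R &
       (1 / 3 - 5 * q) * #|V|%:R <= #|C'|%:R] &
    [/\ cyclic_triple E (20 * q) A' U, cyclic_triple E (20 * q) U C' &
        cyclic_triple E (20 * q) C' A']].
Proof.
move=> HE dE; set N := #|V|%:R => N32 e0 eq d0 dq s0 sq q0 q1 es sqd UC U3 C3 UCt.
have N0 : 0 < N by lra.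
have mulN (a b : R) : a <= b -> a * N <= b * N by move=> ab; rewrite ler_wpM2r // ltW.
have eN := mulN _ _ eq; have dN := mulN _ _ dq; have sN := mulN _ _ sq.
have sqdN := mulN _ _ sqd; have qN : 0 < q * N by rewrite mulr_gt0.
have q1N := mulN _ _ q1; have d0N : 0 <= d * N by rewrite mulr_ge0 // ltW.
have e0N : 0 < e * N by rewrite mulr_gt0.
have q2 : 8 * q ^+ 2 <= q by rewrite expr2; nra.
have q3 : q ^+ 3 <= q.
  by rewrite exprS -[leRHS]mulr1 ler_wpM2l ?(ltW q0) // exprn_ile1 // ?ltW //; lra.
have s3 : s ^+ 3 <= s ^+ 2 * s by rewrite -exprSr.
have q2N := mulN _ _ q2; have q3N := mulN _ _ q3.
have s2N : 0 <= s ^+ 2 * N by rewrite mulr_ge0 ?exprn_ge0 // ltW.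
have G_ge x y : x != y -> (1 / 3 - d) * N <= #|nbh E x y|%:R.
  move=> xy; apply: le_trans (dE _ _ xy) _; rewrite ler_nat; apply: subset_leq_card.
  by apply/subsetP => z; rewrite !inE.
have split3 (X Y Z : {set V}) : ~: Z \subset X :|: Y ->
    forall S : {set V}, #|S :\: Z|%:R <= #|S :&: X|%:R + #|S :&: Y|%:R :> R.
  move=> XYZ S; rewrite -natrD ler_nat; apply: leq_trans (leq_card_setU _ _).
  apply: subset_leq_card; apply/subsetP => z; rewrite -setIUr in_setD in_setI => /andP[zZ ->] /=.
  by apply: (subsetP XYZ); rewrite inE.
have cardID (X Y : {set V}) : #|X :&: Y|%:R + #|X :\: Y|%:R = #|X|%:R :> R.
  by rewrite -natrD cardsID.
have sub_le (X Y : {set V}) : X \subset Y -> #|X|%:R <= #|Y|%:R :> R.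
  by move=> XY; rewrite ler_nat subset_leq_card.
have chain (X Y Z : {set V}) : #|X :\: Z|%:R <= #|X :\: Y|%:R + #|Y :\: Z|%:R :> R.
  rewrite -natrD ler_nat !card_sum_in -big_split /=; apply: leq_sum => z _.
  by rewrite !inE; case: (z \in X); case: (z \in Y); case: (z \in Z).
have [|||C1 [C1C C1_large C1G]] := rotate (R := R) HE (X := U) (Y := C) (t := 12 * e) s0 _ N32 _ _.
- by lra.
- by rewrite -/N; lra.
- by move=> u v uU vU uv; have [_] := UCt u v uU vU uv.
have {}C1_large : #|C :\: C1|%:R <= s * N.
  have s2 : 0 < s ^+ 2 by rewrite exprn_gt0.
  rewrite -(ler_pM2r s2); apply: le_trans C1_large _; rewrite -/N [leRHS]mulrAC.
  by rewrite -exprS ler_wpM2r // ltW.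
have C1_ge : (1 / 3 - 3 * q) * N <= #|C1|%:R.
  by have := cardID C C1; rewrite (setIidPr C1C); lra.
pose A0 := ~: (U :|: C).
have A0_card : #|A0|%:R + #|U|%:R + #|C|%:R = N.
  have UC0 : U :&: C = set0 by apply/eqP; rewrite setI_eq0.
  rewrite -!natrD; congr (_%:R); rewrite -addnA -(cardsUI U C) UC0 cards0 addn0.
  by rewrite addnC cardsC.
(* Avoiding [C] costs [12 * e], avoiding [U] costs [8 * s ^ 2]. Conversely [A0] has at most
   [(1 / 3 + 4 * e) * N] vertices and the neighbourhood at least [(1 / 3 - d) * N], hence
   [16 * e + d]. *)
have GC1 y y' : y \in C1 -> y' \in C1 -> y != y' ->
    #|nbh E y y' :\: A0|%:R <= q ^+ 3 * N /\ #|A0 :\: nbh E y y'|%:R <= q ^+ 3 * N.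
  move=> yC yC' yy'; have [g1 g2] := C1G y y' yC yC' yy'.
  have g3 := split3 U C A0 _ (nbh E y y'); rewrite setCK subxx in g3.
  have {}g3 := g3 isT; have g4 := cardID (nbh E y y') A0; have g5 := cardID A0 (nbh E y y').
  have g6 := G_ge y y' yy'; rewrite setIC in g5; rewrite -/N in g1 g2.
  by split; lra.
have [|||A1 [A1A A1_large A1G]] :=
  rotate (R := R) HE (X := C1) (Y := A0) (t := q ^+ 3) q0 _ N32 _ _.
- by lra.
- by rewrite -/N; lra.
- by move=> u v uC vC uv; have [] := GC1 u v uC vC uv.
have {}A1_large : #|A0 :\: A1|%:R <= q * N.
  have s2 : 0 < q ^+ 2 by rewrite exprn_gt0.
  rewrite -(ler_pM2r s2); apply: le_trans A1_large _; rewrite -/N [leRHS]mulrAC.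
  by rewrite -exprS.
have A0_ge : (1 / 3 - 2 * q) * N <= #|A0|%:R.
  have C1_gt1 : (1 < #|C1|)%N by rewrite -(ltr_nat R); lra.
  have [y [y' [yC yC' yy']]] := card_gt1P C1_gt1.
  have [g1 g2] := GC1 y y' yC yC' yy'; have g3 := G_ge y y' yy'.
  have g4 := cardID (nbh E y y') A0; have g5 := sub_le _ _ (subsetIr (nbh E y y') A0).
  by lra.
have A1U : [disjoint A1 & U].
  rewrite -setI_eq0; apply/eqP/setP => z; rewrite !inE; apply/negbTE/negP => /andP[zA zU].
  by have := subsetP A1A z zA; rewrite !inE zU.
have A1C : [disjoint C1 & A1].
  rewrite -setI_eq0; apply/eqP/setP => z; rewrite !inE; apply/negbTE/negP => /andP[zC zA].
  by have := subsetP A1A z zA; rewrite !inE (subsetP C1C z zC) orbT.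
exists A1, C1; split; split => //.
- exact: disjointWr C1C UC.
- by have := cardID A0 A1; rewrite (setIidPr A1A); lra.
- by lra.
- by lra.
- move=> u v uA vA uv; have [g1 g2] := A1G u v uA vA uv; rewrite -/N in g1 g2 *.
  have g3 : #|nbh E u v :&: C|%:R <= #|nbh E u v :&: C1|%:R + #|C :\: C1|%:R :> R.
    rewrite -natrD ler_nat !card_sum_in -big_split /=; apply: leq_sum => z _.
    by rewrite !inE; case: (z \in C); case: (z \in C1); case: (E u v z).
  have g4 := split3 A0 C U _ (nbh E u v).
  have {}g4 : #|nbh E u v :\: U|%:R <= #|nbh E u v :&: A0|%:R + #|nbh E u v :&: C|%:R :> R.
    apply: g4; apply/subsetP => z; rewrite !inE => /negbTE->; by case: (z \in C).
  have g5 := cardID (nbh E u v) U; have g6 := cardID U (nbh E u v).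
  have g7 := G_ge u v uv; rewrite setIC in g6.
  by split; lra.
- move=> u v uU vU uv; have [g1 g2] := UCt u v uU vU uv; rewrite -/N in g1 g2 *.
  have g3 := chain (nbh E u v) C C1; have g4 := sub_le _ _ (setSD (nbh E u v) C1C).
  by split; lra.
- move=> u v uC vC uv; have [g1 g2] := GC1 u v uC vC uv.
  have g3 := chain (nbh E u v) A0 A1; have g4 := sub_le _ _ (setSD (nbh E u v) A1A).
  by rewrite -/N; split; lra.
Qed.

Theorem tri_structure (h : R) : 0 < h -> exists (d : R) (n0 : nat), 0 < d /\
  forall (V : finType) (E : V -> V -> V -> bool), indep_nbhs E -> (n0 <= #|V|)%N ->
    codegree_ge (1 / 3 - d) E ->
  exists A B C : {set V}, [/\ [/\ [disjoint A & B], [disjoint B & C] & [disjoint C & A]],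
    [/\ (1 / 3 - h) * #|V|%:R <= #|A|%:R, (1 / 3 - h) * #|V|%:R <= #|B|%:R &
       (1 / 3 - h) * #|V|%:R <= #|C|%:R] &
    [/\ cyclic_triple E h A B, cyclic_triple E h B C & cyclic_triple E h C A]].
Proof.
move=> h0; pose q := Num.min (h / 20) (1 / 100).
have q0 : 0 < q by rewrite lt_min !divr_gt0.
have q1 : q <= 1 / 100 by rewrite ge_min lexx orbT.
have qh : q <= h / 20 by rewrite ge_min lexx.
(* The scales are chosen backwards from the final error, then the base size [2000 / e ^ 3], and only
   then the codegree error. *)
pose s := q ^+ 3 / 16; pose e := s ^+ 3 / 12.
have q3 : q ^+ 3 <= q.
  by rewrite exprS -[leRHS]mulr1 ler_wpM2l ?(ltW q0) // exprn_ile1 // ?ltW //; lra.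
have q30 : 0 < q ^+ 3 by rewrite exprn_gt0.
have s0 : 0 < s by rewrite divr_gt0.
have sq : s <= q by rewrite /s; lra.
have s1 : s <= 1 / 1600 by rewrite /s; lra.
have s2 : s ^+ 2 <= s / 1600 by rewrite expr2; nra.
have s3 : s ^+ 3 <= s ^+ 2 by rewrite exprS expr2; nra.
have s30 : 0 < s ^+ 3 by rewrite exprn_gt0.
have e0 : 0 < e by rewrite divr_gt0.
have es : e <= s / 1600 by rewrite /e; lra.
have e3e : e ^+ 3 <= e.
  by rewrite exprS -[leRHS]mulr1 ler_wpM2l ?(ltW e0) // exprn_ile1 // ?ltW //; lra.
have e8 : e <= 1 / 8 by lra.
have eq : e <= q by lra.
have es3 : 12 * e <= s ^+ 3 by rewrite /e; lra.
have sqe d' : d' <= e -> 8 * s ^+ 2 + 16 * e + d' <= q ^+ 3.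
  by move=> d'e; rewrite /s in s2 es *; lra.
have e30 : 0 < e ^+ 3 by rewrite exprn_gt0.
have d'e d' : d' <= e ^+ 3 / 2000 -> d' <= e.
  move/le_trans; apply; rewrite ler_pdivrMr //; apply: le_trans e3e _.
  by apply: ler_peMr; rewrite ?ler1n // ltW.
have q20 (N : R) : 0 <= N -> 5 * q * N <= h * N /\ 20 * q * N <= h * N.
  by move=> N0; split; rewrite ler_wpM2r //; lra.
clear s1 s2 s3 es q3 qh.
have [n0 Hn0] := ex_natr_ge (2000 / e ^+ 3).
have [d [n1 [d0 H]]] := exists_book n0.
have [n2 Hn2] := ex_natr_ge (32 : R).
pose d' := Num.min d (e ^+ 3 / 2000).
have d'0 : 0 < d' by rewrite lt_min d0 divr_gt0.
exists d', (maxn n1 n2); split=> // V E HE; rewrite geq_max => /andP[V1 V2] dE.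
have d'e3 : d' <= e ^+ 3 / 2000 by rewrite ge_min lexx orbT.
have [|Q [w0 [w1 [x [nQ w01 w0x w1x]]]]] := H V E HE V1.
  by apply: codegree_ge_le dE; rewrite lerD2l lerN2 ge_min lexx.
have rbig : 2000 <= #|Q|%:R * e ^+ 3 by rewrite -ler_pdivrMr //; apply: Hn0.
have [U [UC U3 C3 UCt]] := book_structure HE dE w01 w0x w1x e0 e8 rbig d'e3.
have d'e' := d'e _ d'e3.
have [A [C' [dis card_ge tri]]] := cyclic_triple_of_book HE dE (Hn2 _ V2) e0 eq (ltW d'0)
  (le_trans d'e' eq) s0 sq q0 q1 es3 (sqe _ d'e') UC U3 C3 UCt.
exists A, U, C'; have N0 : 0 <= #|V|%:R :> R by [].
have [qN hN] := q20 _ N0; clear rbig d'e3 Hn0 Hn2 V2 H.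
split=> //.
  by case: card_ge => g1 g2 g3; split; lra.
have weaken (X Y : {set V}) : cyclic_triple E (20 * q) X Y -> cyclic_triple E h X Y.
  by move=> XY u v uX vX uv; have [g1 g2] := XY u v uX vX uv; split; lra.
by case: tri => t1 t2 t3; split; apply: weaken.
Qed.

End Structure.

(** * Counting edits *)

Lemma balanced_extension (V : finType) (A1 B1 C1 : {set V}) (a b c : nat) :
  [disjoint A1 & B1] -> [disjoint B1 & C1] -> [disjoint C1 & A1] ->
  (#|A1| <= a)%N -> (#|B1| <= b)%N -> (#|C1| <= c)%N -> (a + b + c = #|V|)%N ->
  exists A0 B0 C0 : {set V}, [/\ tripartition A0 B0 C0,
    [/\ A1 \subset A0, B1 \subset B0 & C1 \subset C0] & [/\ #|A0| = a, #|B0| = b & #|C0| = c]].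
Proof.
move=> AB BC CA Aa Bb Cc abc; pose S := ~: (A1 :|: B1 :|: C1).
have S_card : (#|A1| + #|B1| + #|C1| + #|S| = #|V|)%N.
  rewrite -(cardsC (A1 :|: B1 :|: C1)) -/S; congr addn.
  rewrite cardsU (_ : _ :&: C1 = set0) ?cards0 ?subn0.
    by rewrite cardsU (_ : A1 :&: B1 = set0) ?cards0 ?subn0 //; apply/eqP; rewrite setI_eq0.
  apply/setP => v; rewrite !inE; apply/negbTE/negP => /andP[/orP[]vX vC].
    by rewrite (disjointFr CA vC) in vX.
  by rewrite (disjointFr BC vX) in vC.
have inS v : v \in S -> [/\ v \notin A1, v \notin B1 & v \notin C1].
  by rewrite !inE !negb_or => /andP[/andP[]].
have [|X XS Xk] := exists_subset (S := S) (k := a - #|A1|); first by lia.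
have SX : (#|S :\: X| = #|S| - (a - #|A1|))%N by rewrite cardsD (setIidPr XS) Xk.
have [|Y YS Yk] := exists_subset (S := S :\: X) (k := b - #|B1|); first by lia.
have XYd : [disjoint X & Y].
  rewrite -setI_eq0; apply/eqP/setP => v; rewrite !inE; apply/negbTE/negP => /andP[vX vY].
  by have := subsetP YS v vY; rewrite inE vX.
have YS' : Y \subset S by apply: subset_trans YS (subsetDl _ _).
have dA : [disjoint A1 & X].
  rewrite disjoint_sym -setI_eq0; apply/eqP/setP => v; rewrite !inE.
  by apply/negbTE/negP => /andP[/(subsetP XS)/inS[/negPf->]].
have dB : [disjoint B1 & Y].
  rewrite disjoint_sym -setI_eq0; apply/eqP/setP => v; rewrite !inE.
  by apply/negbTE/negP => /andP[/(subsetP YS')/inS[_ /negPf->]].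
have cA : #|A1 :|: X| = a.
  by rewrite cardsU (eqP (_ : A1 :&: X == set0)) ?setI_eq0 // cards0; lia.
have cB : #|B1 :|: Y| = b.
  by rewrite cardsU (eqP (_ : B1 :&: Y == set0)) ?setI_eq0 // cards0; lia.
have d0 : [disjoint A1 :|: X & B1 :|: Y].
  rewrite -setI_eq0; apply/eqP/setP => v; rewrite !inE; apply/negbTE/negP.
  move=> /andP[/orP[]h1 /orP[]h2].
  - by rewrite (disjointFr AB h1) in h2.
  - by have [] := inS v (subsetP YS' v h2); rewrite h1.
  - by have [_] := inS v (subsetP XS v h1); rewrite h2.
  - by rewrite (disjointFr XYd h1) in h2.
exists (A1 :|: X), (B1 :|: Y), (~: (A1 :|: X :|: (B1 :|: Y))); split.
- rewrite /tripartition d0 setUCr eqxx andbT /=; apply/andP; split; rewrite -setI_eq0;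
    apply/eqP/setP => v; rewrite !inE; by [case: (v \in B1); case: (v \in Y); rewrite ?orbT
    | case: (v \in A1); case: (v \in X); rewrite ?andbF].
- split; [exact: subsetUl | exact: subsetUl |].
  apply/subsetP => v vC; rewrite !inE !negb_or.
  rewrite (disjointFr CA vC) (disjointFl BC vC) /=; apply/andP; split.
    by apply: contraL vC => /(subsetP XS)/inS[].
  by apply: contraL vC => /(subsetP YS')/inS[].
- split=> //; rewrite cardsCs setCK cardsU.
  rewrite (eqP (_ : (A1 :|: X) :&: (B1 :|: Y) == set0)) ?setI_eq0 //.
  by rewrite cards0 subn0 cA cB; lia.
Qed.

Section Count.
Variable R : archiRealFieldType.
Variables (V : finType) (G : graph3 V) (A B C A1 B1 C1 : {set V}) (h : R).
Local Notation N := (#|V|%:R : R).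
Local Notation E := (adj G).
Hypotheses (HE : indep_nbhs E) (h0 : 0 < h) (h1 : h <= 1 / 24).
Hypotheses (tAB : cyclic_triple E h A B) (tBC : cyclic_triple E h B C)
  (tCA : cyclic_triple E h C A).
Hypotheses (A1A : A1 \subset A) (B1B : B1 \subset B) (C1C : C1 \subset C).
Hypothesis A1_ge : N / 4 <= #|A1|%:R.

Lemma card_wrong_pairs (X X1 Y : {set V}) : X1 \subset X -> cyclic_triple E h X Y ->
  #|wrong_pairs G X1 Y|%:R <= 2 * h * N ^+ 3.
Proof.
move=> X1X t.
have -> : #|wrong_pairs G X1 Y| = (\sum_(q : V * V) #|[pred z | (q \in off_diag X1) &&
    (E q.1 q.2 z != (z \in Y))]|)%N.
  rewrite -(card_pair_dep (fun q z => (q \in off_diag X1) && (E q.1 q.2 z != (z \in Y)))).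
  by apply: eq_card => s; rewrite !inE.
rewrite natr_sum; apply: le_trans (_ : \sum_(q : V * V) 2 * h * N <= _); last first.
  by rewrite sumr_const -[leLHS]mulr_natr card_prod natrM !exprS expr0; lra.
have hN : 0 <= 2 * h * N by rewrite !mulr_ge0 // ltW.
apply: ler_sum => -[u v] _ /=.
have [q|q] := boolP ((u, v) \in off_diag X1); last first.
  by rewrite (_ : #|_| = 0%N) //; apply: eq_card0.
move: q; rewrite inE => /and3P[/= uX vX uv].
have [g1 g2] := t u v (subsetP X1X u uX) (subsetP X1X v vX) uv.
apply: le_trans (_ : #|nbh E u v :\: Y|%:R + #|Y :\: nbh E u v|%:R <= _); last by lra.
rewrite -natrD ler_nat; apply: leq_trans (leq_card_setU _ _).
apply: subset_leq_card; apply/subsetP => z; rewrite !inE /=.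
by case: (E u v z); case: (z \in Y).
Qed.

Let missing x y := #|[set a in A1 | ~~ E x y a]|.

(* Two neighbours [c], [c'] of [x], [y] in [C] have almost all of [A] as common
   neighbourhood, which must avoid that of [x], [y]. *)
Let rainbow_at x y : x \in A1 -> y \in B1 ->
  (#|[set z in C1 | E x y z]| <= 1 + 8 * missing x y)%N.
Proof.
move=> xA yB; have [S1|S1] := leqP #|[set z in C1 | E x y z]| 1.
  by apply: leq_trans S1 (leq_addr _ _).
have [c [c' [cS cS' cc']]] := card_gt1P S1.
move: cS cS'; rewrite !inE => /andP[cC xc] /andP[cC' xc'].
have [_ g] := tCA (subsetP C1C c cC) (subsetP C1C c' cC') cc'.
have {}g := card_setI_disjoint (nbh_disjoint HE xc xc') g.
apply: leq_trans (max_card _) _; rewrite -(ler_nat R) natrD natrM.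
have : (#|A1| <= #|nbh E x y :&: A| + missing x y)%N.
  apply: leq_trans (leq_card_setU _ _); apply: subset_leq_card; apply/subsetP => a aA.
  by rewrite !inE aA (subsetP A1A a aA); case: (E x y a).
(* At least [N / 4 - N / 24] vertices of [A1] are missing, more than [N / 8], so [8 * missing x y]
   exceeds the trivial bound [N]. *)
rewrite -(ler_nat R) natrD => g'; have := h1; have := A1_ge => g2 g3.
have hN : h * N <= 1 / 24 * N by rewrite ler_wpM2r.
have N0 : 0 <= N by [].
lra.
Qed.

(** Summing over [a] instead, each [a != x] misses at most [h * N] vertices of [B] because [x] and
    [a] are a pair of [A]; the term [N] is the degenerate [a = x]. *)
Let sum_missing x : x \in A1 -> (\sum_(y in B1) missing x y)%:R <= N + h * N ^+ 2.
Proof.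
move=> xA; rewrite sum_card_sym (bigD1 x) //= natrD; apply: lerD.
  by rewrite ler_nat max_card.
rewrite natr_sum; apply: le_trans (_ : \sum_(a in A1 :\ x) h * N <= _).
  rewrite [leLHS](eq_bigl (mem (A1 :\ x))) => [|a]; last by rewrite !inE andbC.
  apply: ler_sum => a; rewrite !inE => /andP[ax aA].
  have xa : x != a by rewrite eq_sym.
  have [_ g] := tAB (subsetP A1A x xA) (subsetP A1A a aA) xa.
  apply: le_trans g; rewrite ler_nat; apply: subset_leq_card; apply/subsetP => y.
  by rewrite !inE => /andP[yB]; rewrite (adjC23 HE) (subsetP B1B y yB) andbT.
rewrite sumr_const -[leLHS]mulr_natr expr2 mulrA ler_wpM2l ?ler_nat ?max_card //.
by rewrite mulr_ge0 // ltW.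
Qed.

Lemma card_rainbow : #|[set t : V * V * V | [&& t.1.1 \in A1, t.1.2 \in B1, t.2 \in C1 &
  E t.1.1 t.1.2 t.2]]|%:R <= 9 * N ^+ 2 + 8 * h * N ^+ 3.
Proof.
have step : (#|[set t : V * V * V | [&& t.1.1 \in A1, t.1.2 \in B1, t.2 \in C1 &
    E t.1.1 t.1.2 t.2]]| <= \sum_(x in A1) \sum_(y in B1) (1 + 8 * missing x y))%N.
  rewrite cardsE (card_pair_dep (fun q z => [&& q.1 \in A1, q.2 \in B1, z \in C1 & E q.1 q.2 z])).
  rewrite pair_big_dep /= [leqRHS]big_mkcond leq_sum // => -[x y] _ /=.
  case: ifP => [/andP[xA yB]|xy].
    apply: leq_trans (rainbow_at xA yB); apply: subset_leq_card; apply/subsetP => z.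
    by rewrite !inE xA yB.
  by rewrite eq_card0 // => z; rewrite !inE /= andbA xy.
apply: le_trans (_ : (\sum_(x in A1) \sum_(y in B1) (1 + 8 * missing x y))%:R <= _).
  by rewrite ler_nat.
rewrite natr_sum; apply: le_trans (_ : \sum_(x in A1) (9 * N + 8 * (h * N ^+ 2)) <= _).
  apply: ler_sum => x xA; rewrite big_split -big_distrr /= sum1_card natrD natrM.
  have := sum_missing xA.
  have : #|B1|%:R <= N by rewrite ler_nat max_card.
  by lra.
have N0 : 0 <= N by []. have hp := ltW h0.
rewrite sumr_const -[leLHS]mulr_natr.
apply: le_trans (_ : (9 * N + 8 * (h * N ^+ 2)) * N <= _).
  rewrite ler_wpM2l ?ler_nat ?max_card // addr_ge0 ?mulr_ge0 //.
by rewrite !exprS expr0; lra.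
Qed.

(** [17 = 3 + 3 * 2 + 8] and [12 = 3 + 9], from the rest, the three kinds of wrong pairs and the
    rainbow edges. *)
Lemma card_wrong_triples : #|~: (A1 :|: B1 :|: C1)|%:R <= 3 * h * N + 3 ->
  #|wrong_triples G A B C A1 B1 C1|%:R <= 17 * h * N ^+ 3 + 12 * N ^+ 2.
Proof.
move=> rest_le.
have r1 : #|[set t : V * V * V | t.1.1 \in ~: (A1 :|: B1 :|: C1)]|%:R <= (3 * h * N + 3) * N ^+ 2.
  rewrite (_ : [set t | _] = setX (setX (~: (A1 :|: B1 :|: C1)) [set: V]) [set: V]).
    by rewrite !cardsX !cardsT !natrM -mulrA -expr2 ler_wpM2r // exprn_ge0.
  by apply/setP => -[[x y] z]; rewrite in_setX in_setX !in_setT !andbT inE.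
have r2 := card_wrong_pairs A1A tAB; have r3 := card_wrong_pairs B1B tBC.
have r4 := card_wrong_pairs C1C tCA; have r5 := card_rainbow.
have := leq_trans (leq_card_setU _ _) (leq_add (leq_trans (leq_card_setU _ _) (leq_add
  (leqnn #|[set t : V * V * V | t.1.1 \in ~: (A1 :|: B1 :|: C1)]|)
  (leq_trans (leq_card_setU _ _) (leq_add (leq_card_setU (wrong_pairs G A1 B) (wrong_pairs G B1 C))
     (leqnn #|wrong_pairs G C1 A|)))))
  (leqnn #|[set t : V * V * V | [&& t.1.1 \in A1, t.1.2 \in B1, t.2 \in C1 &
  E t.1.1 t.1.2 t.2]]|)).
rewrite -/(wrong_triples G A B C A1 B1 C1) -(ler_nat R) !natrD => H.
apply: le_trans H _; move: r1 r2 r3 r4 r5; rewrite !exprS expr0; lra.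
Qed.

End Count.

(** Amounts to [2 * (n - 1) * (n - 2) >= n ^ 2], true from [n = 6] on. *)
Lemma bin3_ge (R : realFieldType) (n : nat) : (6 <= n)%N ->
  n%:R ^+ 3 / 12 <= 'C(n, 3)%:R :> R.
Proof.
case: n => [|[|n]] // n6.
have E : ('C(n.+2, 3) * 6 = n.+2 * (n.+1 * n))%N.
  by have := bin_ffact n.+2 3; rewrite !ffactnS ffactn0 muln1.
have {}E : 'C(n.+2, 3)%:R * 6 = (n%:R + 1 + 1) * ((n%:R + 1) * n%:R) :> R.
  by rewrite !natr1 -!natrM -E natrM.
have n4 : 4 <= n%:R :> R by rewrite ler_nat.
have -> : n.+2%:R = n%:R + 1 + 1 :> R by rewrite !natr1.
move: E n4; move: (n%:R : R) ('C(_, 3)%:R : R) => x y E x4.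
have -> : y = (x + 1 + 1) * ((x + 1) * x) / 6 by rewrite -E mulfK //; lra.
have h : 0 <= (x - 4) * (x + 2) by rewrite mulr_ge0; lra.
have {}h : 0 <= (x + 2) * ((x - 4) * (x + 2) + 4) by rewrite mulr_ge0 ?addr_ge0 //; lra.
by rewrite !exprS expr0; lra.
Qed.

Lemma min_codegree_ge (R : realFieldType) (d : R) (V : finType) (G : graph3 V) :
  d * #|V|%:R <= (min_codegree G)%:R -> codegree_ge d (adj G).
Proof.
move=> dG x y xy; apply: le_trans dG _; rewrite ler_nat.
apply: leq_trans (codegree_le G xy).
exact: (@bigminn_leq _ _ (fun p : V * V => p.1 != p.2) _ (x, y)).
Qed.

Lemma thirds (n : nat) : exists a b c : nat, [/\ (a + b + c = n)%N,
  [/\ (n <= 3 * a + 3)%N, (n <= 3 * b + 3)%N & (n <= 3 * c + 3)%N] &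
  [&& differ_by_at_most_1 a b, differ_by_at_most_1 b c & differ_by_at_most_1 c a]].
Proof.
exists (n %/ 3)%N, ((n + 1) %/ 3)%N, ((n + 2) %/ 3)%N.
by split; [lia | split; lia | rewrite /differ_by_at_most_1; lia].
Qed.

Theorem theorem1p3 (R : realType) (eps : R) (eps_gt0 : 0 < eps) :
  exists (delta : R) (n0 : nat), 0 < delta /\
    forall (V : finType) (G : graph3 V),
      (n0 <= #|V|)%N ->
      F32_free G ->
      (1 / 3 - delta) * #|V|%:R <= (min_codegree G)%:R ->
      exists A B C : {set V},
        [/\ tripartition A B C, balanced A B C &
            (edit_distance G (T A B C))%:R <= eps * 'C(#|V|, 3)%:R].
Proof.
pose h : R := Num.min (eps / 500) (1 / 30).
have h0 : 0 < h by rewrite lt_min !divr_gt0.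
have h_eps : h <= eps / 500 by rewrite ge_min lexx.
have h30 : h <= 1 / 30 by rewrite ge_min lexx orbT.
have [d [n0 [d0 H]]] := tri_structure h0.
have [n1 Hn1] := ex_natr_ge (1000 / eps).
have [n2 Hn2] := ex_natr_ge (100 : R).
exists d, (maxn 6 (maxn n0 (maxn n1 n2))); split=> // V G.
rewrite !geq_max => /and4P[V6 V0 /Hn1 V1 /Hn2 V2] free /min_codegree_ge dG.
have HE := adj_indep_nbhs free.
have [A [B [C [[AB BC CA] [A3 B3 C3] [tA tB tC]]]]] := H V (adj G) HE V0 dG.
set n := #|V| in V6 V1 V2 A3 B3 C3 *; set N : R := n%:R in V1 V2 A3 B3 C3 *.
have [a [b [c [abc [na nb nc] bal]]]] := thirds n.
(* Each class is trimmed to at most its balanced size, so that it can be completed without moving a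
   vertex; the [- 1] is the rounding in [thirds]. *)
have part (X : {set V}) (k : nat) : (n <= 3 * k + 3)%N -> (1 / 3 - h) * N <= #|X|%:R ->
    exists X1 : {set V}, [/\ X1 \subset X, (#|X1| <= k)%N & (1 / 3 - h) * N - 1 <= #|X1|%:R].
  rewrite -(ler_nat R) natrD natrM -/N => hk X3.
  have [X1 X1X X1k] := exists_subset (geq_minl #|X| k).
  exists X1; split=> //; first by rewrite X1k geq_minr.
  have hN : 0 <= h * N by rewrite mulr_ge0 ?ler0n // ltW.
  by rewrite X1k /minn; case: ifP => _; clear -hk X3 hN; lra.
have [A1 [A1A A1a A1g]] := part A a na A3.
have [B1 [B1B B1b B1g]] := part B b nb B3.
have [C1 [C1C C1c C1g]] := part C c nc C3.
have AB1 : [disjoint A1 & B1] by apply: disjointWl A1A (disjointWr B1B AB).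
have BC1 : [disjoint B1 & C1] by apply: disjointWl B1B (disjointWr C1C BC).
have CA1 : [disjoint C1 & A1] by apply: disjointWl C1C (disjointWr A1A CA).
have [A0 [B0 [C0 [tri [A10 B10 C10] [cA cB cC]]]]] :=
  balanced_extension AB1 BC1 CA1 A1a B1b C1c abc.
exists A0, B0, C0; split=> //.
  by rewrite /balanced cA cB cC.
have [AB0 BC0 CA0 _] := and4P tri.
apply: le_trans (_ : (#|edits G (T A0 B0 C0)|)%:R <= _); first by rewrite ler_nat edit_distance_le.
apply: le_trans (_ : #|wrong_triples G A B C A1 B1 C1|%:R <= _).
  by rewrite ler_nat; apply: card_edits_le.
have hN : h * N <= 1 / 30 * N by rewrite ler_wpM2r // ler0n.
apply: le_trans (card_wrong_triples HE h0 _ tA tB tC A1A B1B C1C _ _) _.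
- by lra.
- by rewrite -/n -/N; lra.
- have I0 (X Y : {set V}) : [disjoint X & Y] -> #|X :|: Y|%:R = #|X|%:R + #|Y|%:R :> R.
    by move=> XY; rewrite cardsU (eqP (_ : X :&: Y == set0)) ?setI_eq0 // cards0 subn0 natrD.
  have ABC1 : [disjoint A1 :|: B1 & C1].
    by rewrite disjoints_subset subUset -!disjoints_subset BC1 disjoint_sym CA1.
  have : #|A1 :|: B1 :|: C1|%:R + #|~: (A1 :|: B1 :|: C1)|%:R = N.
    by rewrite -natrD cardsC.
  by rewrite (I0 _ _ ABC1) (I0 _ _ AB1) -/n -/N; lra.
have C3n := bin3_ge R V6; rewrite -/N in C3n.
rewrite -/n -/N; apply: le_trans (_ : eps * (N ^+ 3 / 12) <= _); last first.
  by rewrite ler_pM2l.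
have N2 : 0 <= N ^+ 2 by rewrite exprn_ge0 // ler0n.
have N3 : 0 <= N ^+ 3 by rewrite exprn_ge0 // ler0n.
(* The final count: [17 / 500 + 12 / 1000] is below [1 / 12]. *)
have g1 : h * N ^+ 3 <= eps / 500 * N ^+ 3 by rewrite ler_wpM2r.
have g2 : 1000 * N ^+ 2 <= eps * N ^+ 3.
  rewrite [N ^+ 3]exprS mulrA ler_wpM2r //.
  by move: V1; rewrite ler_pdivrMr // mulrC.
lra.
Qed.
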